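(* Let $A$ be a Fréchet space of sequences as in the context, $X$ a separable topological vector space whose topology is given by an increasing sequence of seminorms, $(x_n)_{n\ge 0}$ a sequence in $X$, and let $\mathcal{U}_A$ be the associated set of restricted universal series. If $\mathcal{U}_A$ is non-empty and there exists a continuous seminorm $p$ on $A$ such that $\ker p$ is not a subspace of finite codimension of $A$, then $\mathcal{U}_A$ is spaceable.
   Context: $\mathbb{K}=\mathbb{R}$ or $\mathbb{C}$, $\mathbb{Z}_+$ is the set of non-negative integers. $A$ is a Fréchet space that is a subspace of $\mathbb{K}^{\mathbb{Z}_+}$ such that the coordinate projections $A\to\mathbb{K}$, $(a_n)_{n\ge0}\mapsto a_m$, are continuous for all $m\ge0$ and such that the set of polynomials $\{a=(a_n)_{n\ge0}\in\mathbb{K}^{\mathbb{Z}_+}:\{n\ge0:a_n\neq0\}\text{ is finite}\}$ is contained and dense in $A$. $(e_n)_{n\ge0}$ is the canonical basis of $\mathbb{K}^{\mathbb{Z}_+}$. Define $S_k:A\to X$ by $S_k((a_n)_{n\ge0})=\sum_{n=0}^k a_nx_n$ and $S^A_k:A\to A$ by $S^A_k((a_n)_{n\ge0})=\sum_{n=0}^k a_ne_n$. A sequence $a\in A$ is a restricted universal series if for every $x\in X$ there exists an increasing sequence $(n_k)$ of positive integers such that $S_{n_k}a\to x$ in $X$ and $S^A_{n_k}a\to a$ in $A$ as $k\to\infty$. $\mathcal{U}_A$ denotes the set of restricted universal series. $\mathcal{U}_A$ is spaceable if $\mathcal{U}_A\cup\{0\}$ contains a closed infinite-dimensional subspace of $A$.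 *)

(* Defs.v *)
From HB Require Import structures.
From mathcomp Require Import all_boot all_order all_algebra.
From mathcomp Require Import complex.
From mathcomp Require Import all_classical all_reals all_analysis.

Set Implicit Arguments.
Unset Strict Implicit.
Unset Printing Implicit Defensive.

Import Order.TTheory GRing.Theory Num.Theory.
Import numFieldNormedType.Exports.

Local Open Scope classical_set_scope.
Local Open Scope ring_scope.

Definition real_or_complex (R : realType) (K : numFieldType) : Prop :=
  K = R :> numFieldType \/ K = R[i] :> numFieldType.

Section Seminorms.
Context {K : numFieldType}.

(* As for norms in MathComp, the values lie in K; nonnegative elements of K
   are real, also when K is the field of complex numbers. *)
Definition seminorm (V : lmodType K) (p : V -> K) : Prop :=
  [/\ forall x, 0 <= p x,
      forall (a : K) x, p (a *: x) = `|a| * p x &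
      forall x y, p (x + y) <= p x + p y].

Definition increasing_seminorms (V : lmodType K) (q : nat -> V -> K) : Prop :=
  (forall n, seminorm (q n)) /\ (forall n x, q n x <= q n.+1 x).

(* Since q is increasing, single balls (rather than finite intersections of
   balls) form a base of neighbourhoods. *)
Definition topology_given_by (V : topologicalLmodType K) (q : nat -> V -> K) :
    Prop :=
  forall x : V, nbhs x =
    filter_from ([set: nat] `*` [set e : K | 0 < e])
                (fun ne => [set y | q ne.1 (x - y) < ne.2]).

Definition countably_seminormed (V : topologicalLmodType K) : Prop :=
  exists2 q : nat -> V -> K, increasing_seminorms q & topology_given_by q.

(* Cauchyness refers to the vector space structure and not to the library's
   entourages: the uniformity of a tvsType need not be translation invariant. *)
Definition tvs_cauchy (V : topologicalLmodType K) (u : nat -> V) : Prop :=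
  forall U : set V, nbhs 0 U -> \forall m & n \near \oo, U (u m - u n).

Definition frechet (V : topologicalLmodType K) : Prop :=
  [/\ hausdorff_space V, countably_seminormed V &
      forall u : nat -> V, tvs_cauchy u -> exists l : V, u @ \oo --> l].

End Seminorms.

Definition separable_space (T : topologicalType) : Prop :=
  exists2 D : set T, countable D & dense D.

Section Dimension.
Context {K : numFieldType} {V : lmodType K}.

Definition linear_span n (b : 'I_n -> V) : set V :=
  [set v | exists c : 'I_n -> K, v = \sum_i c i *: b i].

Definition linear_subspace (W : set V) : Prop :=
  GRing.submod_closed (mem W : {pred V}).

Definition finite_dimensional (W : set V) : Prop :=
  exists n (b : 'I_n -> V), W = linear_span b.

Definition finite_codimensional (W : set V) : Prop :=
  exists n (b : 'I_n -> V),
    forall v, exists w z, [/\ W w, linear_span b z & v = w + z].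

End Dimension.

(* A vector subspace P of K^nat, viewed as a type with \val : A -> (nat -> K^o)
   the (linear) inclusion, carrying a vector space topology of its own. *)
#[short(type="topSubLmodType")]
HB.structure Definition TopSubLmodule (K : numFieldType) (V : lmodType K)
    (P : pred V) :=
  {A of TopologicalLmodule K A & GRing.SubLmodule K P A}.

Section SequenceSpaces.
Context {K : numFieldType}.

Definition polynomial_seq (a : nat -> K) : Prop :=
  finite_set [set n | a n != 0].

Definition canonical_basis (n : nat) : nat -> K^o := fun m => (m == n)%:R.

Context {P : pred (nat -> K^o)} (A : topSubLmodType P).

Definition coordinate (m : nat) (a : A) : K^o := (\val a : nat -> K^o) m.

(* The default value 0 is irrelevant as soon as A contains the polynomials. *)
Definition basisA (n : nat) : A := insubd (0 : A) (canonical_basis n).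

Definition partial_sumA (k : nat) (a : A) : A :=
  \sum_(n < k.+1) coordinate n a *: basisA n.

Context (X : topologicalLmodType K) (x : nat -> X).

Definition partial_sum (k : nat) (a : A) : X :=
  \sum_(n < k.+1) (coordinate n a : K) *: x n.

Definition restricted_universal_series : set A :=
  [set a | forall y : X, exists n : nat -> nat,
     [/\ forall k, (0 < n k)%N, {homo n : i j / (i < j)%N},
         partial_sum (n k) a @[k --> \oo] --> y &
         partial_sumA (n k) a @[k --> \oo] --> a]].

End SequenceSpaces.

Arguments restricted_universal_series {K P} A {X} x.

Definition spaceable (K : numFieldType) (V : topologicalLmodType K)
    (U : set V) : Prop :=
  exists W : set V,
    [/\ linear_subspace W, closed W, ~ finite_dimensional W &
        W `<=` U `|` [set 0]].

(* Main.v *)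
Require Import Defs.
From HB Require Import structures.
From mathcomp Require Import all_boot all_order all_algebra.
From mathcomp Require Import complex.
From mathcomp Require Import all_classical all_reals all_analysis.
From mathcomp Require Import ring lra.

(** One universal series a already yields many small universal polynomials. If
S_m(a) and S_n(a) are partial sums with m < n, both truncations close to a in A
and S_n(a) close to y + S_m(a), then the block of a between m and n is a
polynomial that starts as late as desired, is small in A, and is mapped close
to y (restricted_universal_block). So corrections that are negligible in A can
steer the partial sums in X anywhere.

On the side of A alone, let p_0 <= p_1 <= ... define the topology, with ker p_0
of infinite codimension, and look for polynomials g_k with successive supports,
p_0(g_k) = 1, such that for all j <= i <= m
  p_j(sum_(k < i) c_k g_k) <= 2 p_j(sum_(k < m) c_k g_k).
This is Mazur's construction: a finite net of the unit sphere of
span(g_0, ..., g_(i-1)) is normed by finitely many continuous functionals, and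
any g in their common kernel, a closed subspace of finite codimension, obeys the
inequality (cofinite_almost_orthogonal). Since the polynomials are dense and
ker p_0 has infinite codimension, such a subspace still contains polynomials
with late support on which p_0 does not vanish (cofinite_large_vector).

Both ingredients are interleaved (block_family). The vector u_k starts with g_k.
At stage s, each u_k with k <= s receives one more block, of size at most
4^(-s)/32 in p_s, all of them placed before a common index N_(s+1); at that
index the partial sum of one selected u_k is close to a prescribed member of a
dense sequence of X, and the partial sums of all the other u_k are close to 0.
The corrections are so small that (u_k) is again basic: an element z of the
closed span W of (u_k) has an expansion z = sum_k c_k u_k that converges in A
and has coefficients bounded by 8 p_0(z) (basic_span_expansion,
basic_span_coef_le).

If z is a nonzero element of W, choose k with c_k <> 0. At the stages that
select k with a target near y / c_k, the partial sum of z is close to y, because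
the unwanted contributions add up to at most 8 p_0(z) (s+1) 4^(-s)/32. The
truncations of z at the indices N_(s+1) converge to z, for the same reason and
since the expansion converges. Hence z is a restricted universal series, and W
is a closed subspace of infinite dimension (seminorm_spaceable).

To treat both scalar fields at once, seminorms are made real-valued, and all
that is used of K is collected in real_scalars. *)

Set Implicit Arguments.
Unset Strict Implicit.
Unset Printing Implicit Defensive.

Import Order.TTheory GRing.Theory Num.Theory.
Import numFieldNormedType.Exports.

Local Open Scope classical_set_scope.
Local Open Scope ring_scope.

(** * Choice sequences and the real Hahn-Banach theorem *)

(** Inductive constructions below carry an invariant I that makes the next step
possible, and a relation Q between consecutive stages that is all one wants to
remember afterwards. *)
Lemma invariant_dependent_choice (T : Type) (I : nat -> T -> Prop)
    (Q : nat -> T -> T -> Prop) (t0 : T) :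
  I 0%N t0 -> (forall n t, I n t -> exists t', I n.+1 t' /\ Q n t t') ->
  exists s : nat -> T,
    s 0%N = t0 /\ forall n, I n (s n) /\ Q n (s n) (s n.+1).
Proof.
move=> I0 step.
have stepT n (t : {t | I n t}) : {t' : {t | I n.+1 t} | Q n (sval t) (sval t')}.
  by case: t => t It; have /cid[t' [It' Qt]] := step n t It; exists (exist _ t' It').
pose fix s n : {t | I n t} :=
  if n is m.+1 then sval (stepT m (s m)) else exist _ t0 I0.
exists (fun n => sval (s n)); split => // n; split; first exact: svalP.
by rewrite /=; case: (stepT n (s n)).
Qed.

Lemma mul_le_of_lt_div (R : realFieldType) (C e y : R) :
  0 <= C -> 0 < e -> y < e / (C + 1) -> C * y <= e.
Proof.
move=> C0 e0 /ltW/(ler_wpM2l C0)/le_trans; apply.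
by rewrite mulrCA ler_piMr ?(ltW e0)// ler_pdivrMr ?mul1r ?ltr_wpDl// lerDl.
Qed.

Lemma invS_lt (R : realType) (e : R) s :
  0 < e -> (Num.truncn e^-1 <= s)%N -> s.+1%:R^-1 < e.
Proof.
move=> e0 es; rewrite invf_plt ?posrE// (lt_le_trans (truncnS_gt _))//.
by rewrite ler_nat.
Qed.

Section RealHahnBanach.
Variables (R : realType) (V : lmodType R) (r : V -> R).
Hypothesis semi_r : seminorm r.

Let r_ge0 x : 0 <= r x. Proof. by case: semi_r. Qed.
Let rZ a x : r (a *: x) = `|a| * r x. Proof. by case: semi_r. Qed.
Let rD x y : r (x + y) <= r x + r y. Proof. by case: semi_r. Qed.

(** Zorn's lemma is applied to the subspaces L that are orthogonal to e, in the
sense that adding an element of L never decreases the seminorm of e. A maximal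
one is a hyperplane: any w can be moved along e until it is orthogonal to e
modulo L. Working with subspaces rather than partially defined functionals makes
unions of chains immediate. *)
Lemma Birkhoff_orthogonal_complement (e : V) : 0 < r e ->
  exists L : set V,
    [/\ forall x y, L x -> L y -> L (x + y),
        forall a x, L x -> L (a *: x),
        forall t l, L l -> `|t| * r e <= r (t *: e + l) &
        forall x, exists a, L (x - a *: e)].
Proof.
move=> re0.
pose P (L : set V) := [/\ forall x y, L x -> L y -> L (x + y),
   forall a x, L x -> L (a *: x) & forall l, L l -> r e <= r (e + l)].
have [F FP Ftot|L [[LD LZ Le] Lmax]] := @Zorn_bigcup V P.
  split.
  - move=> x y [X FX Xx] [Y FY Yy]; have [XY|YX] := Ftot _ _ FX FY.
      by exists Y => //; have [+ _ _] := FP _ FY; apply => //; exact: XY.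
    by exists X => //; have [+ _ _] := FP _ FX; apply => //; exact: YX.
  - by move=> a x [X FX Xx]; exists X => //; have [_ + _] := FP _ FX; apply.
  - by move=> x [X FX Xx]; have [_ _ +] := FP _ FX; apply.
(* Chains may be empty, so L = set0 has to be excluded by maximality. *)
have L0 : L 0.
  apply: contrapT => NL0; have Lno x : ~ L x.
    by move=> /(LZ 0); rewrite scale0r.
  apply: (Lmax [set 0]).
    by split => [x /Lno//|/(_ 0 erefl)].
  split => [x y -> ->|a x ->|l ->]; rewrite ?addr0 ?scaler0//.
have scaled t l : L l -> `|t| * r e <= r (t *: e + l).
  move=> Ll; have [->|t0] := eqVneq t 0; first by rewrite normr0 mul0r r_ge0.
  have -> : t *: e + l = t *: (e + t^-1 *: l).
    by rewrite scalerDr scalerA divff// scale1r.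
  by rewrite rZ ler_wpM2l//; apply: Le; exact: LZ.
exists L; split => // w.
(* w - a *: e may join L exactly when |t + a| r(e) <= r(t e + w + l) for all t
   and l in L; B collects the resulting lower bounds for a, and the triangle
   inequality keeps them below all the upper bounds. *)
pose B := [set b | exists t l, L l /\ b = - r (t *: e + w + l) / r e - t].
have Bub t l : L l -> ubound B (r (t *: e + w + l) / r e - t).
  move=> Ll _ [t' [l' [Ll' ->]]].
  have Ldiff : L (l - l') by apply: LD => //; rewrite -scaleN1r; exact: LZ.
  have := scaled (t - t') _ Ldiff.
  have -> : (t - t') *: e + (l - l') =
      (t *: e + w + l) + (-1) *: (t' *: e + w + l').
    by rewrite scalerBl scaleN1r !opprD [in RHS]addrACA [in RHS](addrACA (t *: e)) subrr addr0.
  move=> /le_trans/(_ (rD _ _)); rewrite rZ normrN normr1 mul1r => H.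
  have H' : (t - t') * r e <= r (t *: e + w + l) + r (t' *: e + w + l').
    by apply: le_trans H; rewrite ler_wpM2r// ler_norm.
  rewrite -subr_ge0 in H'; rewrite -subr_ge0.
  rewrite [leRHS](_ : _ = (r (t *: e + w + l) + r (t' *: e + w + l')
     - (t - t') * r e) / r e); first exact: divr_ge0 (ltW re0).
  by field; rewrite gt_eqF.
have Bsup : has_sup B.
  split; first by exists (- r (0 *: e + w + 0) / r e - 0), 0, 0.
  by exists (r (0 *: e + w + 0) / r e - 0); exact: Bub.
pose a := sup B; exists a.
have key t l : L l -> `|t + a| * r e <= r (t *: e + w + l).
  move=> Ll; rewrite -ler_pdivlMr// ler_norml; apply/andP; split.
    have : - r (t *: e + w + l) / r e - t <= a.
      by apply: (ub_le_sup (proj2 Bsup)); exists t, l.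
    by rewrite mulNr lerBlDl.
  have : a <= r (t *: e + w + l) / r e - t by apply: ge_sup (proj1 Bsup) _; exact: Bub.
  by rewrite lerBrDl.
apply: contrapT => NLw.
pose L' := [set x | exists l s, L l /\ x = l + s *: (w - a *: e)].
apply: (Lmax L').
  split; last first.
    move=> L'L; apply: NLw; apply: L'L; exists 0, 1.
    by rewrite scale1r add0r.
  by move=> x Lx; exists x, 0; rewrite scale0r addr0.
split.
- move=> _ _ [l [s [Ll ->]]] [l' [s' [Ll' ->]]].
  by exists (l + l'), (s + s'); split; [exact: LD|rewrite scalerDl addrACA].
- move=> b _ [l [s [Ll ->]]]; exists (b *: l), (b * s).
  by split; [exact: LZ|rewrite scalerDr scalerA].
- move=> _ [l [s [Ll ->]]]; have [->|s0] := eqVneq s 0.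
    by rewrite scale0r addr0; exact: Le.
  have := key (s^-1 - a) (s^-1 *: l) (LZ _ _ Ll).
  rewrite subrK normfV mulrC ler_pdivrMr ?normr_gt0// mulrC -rZ.
  congr (_ <= r _).
  rewrite !scalerDr !scalerA divff// scale1r mulrBr divff// scalerBl scale1r.
  by rewrite scalerN scalerA -!addrA; congr (e + _); rewrite addrC -addrA addrCA.
Qed.

(** The functional is r(e) times the coordinate along e in the decomposition of
the space as the line of e plus its orthogonal hyperplane. *)
Lemma norming_functional (e : V) :
  exists g : {scalar V}, (forall x, `|g x| <= r x) /\ g e = r e.
Proof.
have [re0|re0] := eqVneq (r e) 0.
  exists (@GRing.null_fun V R : {scalar V}); split => //= x.
  by rewrite normr0.
have {}re0 : 0 < r e by rewrite lt_def re0 r_ge0.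
have [L [LD LZ scaled Lw]] := Birkhoff_orthogonal_complement re0.
have /choice[g gL] := Lw.
have guniq x a : L (x - a *: e) -> g x = a.
  move=> Lx; apply/eqP; rewrite -subr_eq0 -normr_eq0 -[_ == _](mulIr_eq0 _ (mulIf (lt0r_neq0 re0))).
  rewrite eq_le mulr_ge0 ?(ltW re0)// andbT.
  have := scaled (g x - a) (-1 *: (x - a *: e) + (x - g x *: e)).
  move=> /(_ (LD _ _ (LZ _ _ Lx) (gL x))); congr (_ <= _).
  rewrite -[RHS](_ : r 0 = 0); last by rewrite -(scale0r (0 : V)) rZ normr0 mul0r.
  by congr r; rewrite scaleN1r opprB scalerBl !addrA !subrK subrr.
have glin : scalar (fun x => r e * g x).
  move=> a x y; rewrite mulrCA -mulrDr; congr (_ * _); apply: guniq.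
  have -> : a *: x + y - (a * g x + g y) *: e
            = a *: (x - g x *: e) + (y - g y *: e).
    by rewrite scalerBr scalerA addrACA scalerDl opprD.
  exact: LD (LZ _ _ (gL x)) (gL y).
pose gl := GRing.isLinear.Build R V R _ _ glin.
pose G : {scalar V} := HB.pack (fun x => r e * g x) gl.
exists G; split => [x|] /=.
  rewrite normrM ger0_norm ?r_ge0// mulrC.
  by have := scaled (g x) _ (gL x); rewrite addrC subrK.
suff -> : g e = 1 by rewrite mulr1.
apply: guniq; rewrite scale1r subrr -(scale0r (e - g e *: e)).
exact: LZ (gL e).
Qed.
End RealHahnBanach.

(** * Real and complex scalars *)

(** An alias of V on which R acts through f; it lets the real Hahn-Banach
theorem be applied to complex spaces. *)
Definition restrict_scalars (R K : pzRingType) (f : {rmorphism R -> K})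
  (V : lmodType K) : Type := V.

Section RestrictScalars.
Variables (R K : pzRingType) (f : {rmorphism R -> K}) (V : lmodType K).

HB.instance Definition _ := GRing.Zmodule.on (restrict_scalars f V).

Let scale (a : R) (x : restrict_scalars f V) : restrict_scalars f V :=
  f a *: (x : V).

Let scaleA a b x : scale a (scale b x) = scale (a * b) x.
Proof. by rewrite /scale scalerA rmorphM. Qed.
Let scale1 : left_id 1 scale.
Proof. by move=> x; rewrite /scale rmorph1 scale1r. Qed.
Let scaleDr : right_distributive scale +%R.
Proof. by move=> a x y; rewrite /scale scalerDr. Qed.
Let scaleDl x : {morph scale^~ x : a b / a + b}.
Proof. by move=> a b; rewrite /scale rmorphD scalerDl. Qed.

HB.instance Definition _ :=
  GRing.Zmodule_isLmodule.Build R (restrict_scalars f V)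
    scaleA scale1 scaleDr scaleDl.

Lemma restrict_scalarsE (a : R) (x : V) :
  a *: (x : restrict_scalars f V) = f a *: x.
Proof. by []. Qed.
End RestrictScalars.

(** All that the proof needs to know about a scalar field K: its nonnegative
elements form a copy of those of R, its balls are totally bounded, and for every
seminorm r each vector e is Birkhoff orthogonal to the kernel of an r-bounded
functional. The constant 2 lets f(x) = g(x) - i g(ix), for g real and bounded by r, be
estimated by the triangle inequality. *)
Record real_scalars (R : realType) (K : numFieldType) := RealScalars {
  re : K -> R;
  emb : {rmorphism R -> K};
  emb_re : forall a, 0 <= a -> emb (re a) = a;
  re_emb : forall r, re (emb r) = r;
  emb_ge0 : forall r, (0 <= emb r) = (0 <= r);
  ball_net : forall D d : R, 0 < d -> exists s : seq K,
    forall a, re `|a| <= D -> exists2 b, b \in s & re `|a - b| <= d;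
  orthogonal_functional : forall (V : lmodType K) (r : V -> R),
    (forall x, 0 <= r x) -> (forall a x, r (a *: x) = re `|a| * r x) ->
    (forall x y, r (x + y) <= r x + r y) ->
    forall e, exists f : {scalar V},
      (forall x, re `|f x| <= 2 * r x) /\ (forall x, f x = 0 -> r e <= r (e + x))
}.

Lemma real_interval_net (R : realType) (D d : R) : 0 < d ->
  exists s : seq R, forall a, `|a| <= D -> exists2 b, b \in s & `|a - b| <= d.
Proof.
move=> d0; pose n := (Num.truncn (D / d)).+1.
exists [seq d * (k%:R - n%:R) | k <- iota 0 (n + n).+1] => a aD.
have Dn : D <= d * n%:R.
  by rewrite -ler_pdivrMl// mulrC ltW// truncnS_gt.
have /andP[aD1 aD2] : - (d * n%:R) <= a <= d * n%:R.
  by rewrite -ler_norml (le_trans aD).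
have a0 : 0 <= a / d + n%:R.
  by rewrite -lerBlDr sub0r ler_pdivlMr// mulNr mulrC.
pose k := Num.truncn (a / d + n%:R).
exists (d * (k%:R - n%:R)).
  apply/mapP; exists k => //; rewrite mem_iota /= add0n ltnS truncn_le_nat.
  have : a / d + n%:R <= n%:R + n%:R by rewrite lerD2r ler_pdivrMr// mulrC.
  by move=> /le_lt_trans; apply; rewrite -natrD ltr_nat.
have /andP[k1 k2] := truncn_itv a0.
have -> : a - d * (k%:R - n%:R) = d * (a / d + n%:R - k%:R).
  by field; rewrite gt_eqF.
rewrite normrM gtr0_norm// ler_piMr ?(ltW d0)// ler_norml.
rewrite -/k in k1 k2; rewrite -(natr1 k) in k2; apply/andP; split; lra.
Qed.

Section RealScalarsOfR.
Variable R : realType.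

Let orthogonal (V : lmodType R) (r : V -> R) :
    (forall x, 0 <= r x) -> (forall a x, r (a *: x) = `|a| * r x) ->
    (forall x y, r (x + y) <= r x + r y) ->
    forall e, exists f : {scalar V},
      (forall x, `|f x| <= 2 * r x) /\ (forall x, f x = 0 -> r e <= r (e + x)).
Proof.
move=> r0 rZ rD e.
have [|g [gr ge]] := @norming_functional R V r _ e; first by split.
exists g; split => x; first by apply: le_trans (gr x) _; rewrite ler_peMl// ler1n.
by move=> gx; rewrite -ge (le_trans _ (gr (e + x)))// linearD /= gx addr0 ler_norm.
Qed.

Definition real_scalars_R : real_scalars R R :=
  @RealScalars R R id idfun (fun _ _ => erefl) (fun _ => erefl)
    (fun _ => erefl) (@real_interval_net R) orthogonal.

End RealScalarsOfR.

Section RealScalarsOfC.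
Variable R : realType.
Local Notation C := R[i].

Lemma Re_norm_le (z : C) : complex.Re `|z| <= `|complex.Re z| + `|complex.Im z|.
Proof.
case: z => x y /=; rewrite -[leRHS]ger0_norm ?addr_ge0// -sqrtr_sqr.
by rewrite ler_wsqrtr// sqrrD !real_normK ?num_real// addrAC lerDl mulrn_wge0// mulr_ge0.
Qed.

Lemma Re_Im_le_norm (z : C) :
  `|complex.Re z| <= complex.Re `|z| /\ `|complex.Im z| <= complex.Re `|z|.
Proof.
case: z => x y /=; rewrite -!sqrtr_sqr.
by split; apply: ler_wsqrtr; rewrite ?lerDl ?lerDr sqr_ge0.
Qed.

Let emb_Re (a : C) : 0 <= a -> (complex.Re a)%:C%C = a.
Proof. by move=> a0; rewrite RRe_real// ger0_real. Qed.

Let net (D d : R) : 0 < d -> exists s : seq C,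
  forall a, complex.Re `|a| <= D -> exists2 b, b \in s & complex.Re `|a - b| <= d.
Proof.
move=> d0; have [|s ns] := @real_interval_net R D (d / 2); first lra.
exists [seq (x +i* y)%C | x <- s, y <- s] => a aD.
have [Ra Ia] := Re_Im_le_norm a.
have [x xs ax] := ns _ (le_trans Ra aD).
have [y ys ay] := ns _ (le_trans Ia aD).
exists (x +i* y)%C; first exact: allpairs_f.
apply: le_trans (Re_norm_le _) _.
by case: a ax ay {aD Ra Ia} => u v /= ax ay; lra.
Qed.

Let orthogonal (V : lmodType C) (r : V -> R) :
    (forall x, 0 <= r x) -> (forall a x, r (a *: x) = complex.Re `|a| * r x) ->
    (forall x y, r (x + y) <= r x + r y) ->
    forall e, exists f : {scalar V},
      (forall x, complex.Re `|f x| <= 2 * r x) /\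
      (forall x, f x = 0 -> r e <= r (e + x)).
Proof.
move=> r0 rZ rD e.
pose VR := restrict_scalars (real_complex R) V.
have semi_r : seminorm (r : VR -> R).
  split => // a x; rewrite restrict_scalarsE rZ; congr (_ * _).
  by rewrite /= expr0n /= addr0 sqrtr_sqr.
have [g [gr ge]] := norming_functional semi_r (e : VR).
(* The complex-linear functional with real part g. *)
pose f (x : V) : C := (g x +i* (- g ('i%C *: x)))%C.
have decomp (a : C) (x : V) :
    a *: x = (complex.Re a *: (x : VR) + complex.Im a *: ('i%C *: x : VR)) :> V.
  rewrite -[RHS]/(((complex.Re a)%:C)%C *: x + ((complex.Im a)%:C)%C *: ('i%C *: x)).
  by rewrite scalerA -scalerDl mulrC -complexE.
have gZ (a : C) (x : V) :
    g (a *: x) = complex.Re a * g x + complex.Im a * g ('i%C *: x).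
  by rewrite decomp linearD !linearZ.
have gD (x y : V) : g (x + y : V) = g x + g y by exact: (linearD g).
have flin : scalar f.
  move=> a x y.
  have E1 : g (a *: x + y : V) =
      complex.Re a * g x + complex.Im a * g ('i%C *: x) + g y.
    by rewrite (gD (a *: x) y) (gZ a x).
  have E2 : g ('i%C *: (a *: x + y) : V) =
      - complex.Im a * g x + complex.Re a * g ('i%C *: x) + g ('i%C *: y).
    have -> : 'i%C *: (a *: x + y) = (a * 'i%C) *: x + 'i%C *: y.
      by rewrite scalerDr scalerA mulrC.
    by rewrite (gD ((a * 'i%C) *: x) ('i%C *: y)) (gZ (a * 'i%C) x) ReiNIm ImiRe.
  rewrite /f E1 E2.
  move: (g x) (g y) (g ('i%C *: x)) (g ('i%C *: y)) => gx gy gix giy.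
  by case: a {E1 E2} => u v; apply/eqP; rewrite eq_complex /=; apply/andP; split; apply/eqP; ring.
pose fl := GRing.isLinear.Build C V C _ f flin.
pose F : {scalar V} := HB.pack f fl.
exists F; split => x.
  rewrite -[F x]/(f x); apply: le_trans (Re_norm_le _) _.
  rewrite /f /= normrN mulr_natl mulr2n.
  apply: lerD; first exact: gr.
  apply: le_trans (gr _) _.
  by rewrite rZ /= expr0n /= add0r expr1n sqrtr1 mul1r.
rewrite -[F x]/(f x) => -[gx _].
have := gr (e + x); rewrite gD gx addr0 ge => /(le_trans _); apply.
exact: ler_norm.
Qed.

Definition real_scalars_C : real_scalars R C :=
  @RealScalars R C (@complex.Re R) (real_complex R) emb_Re (fun _ => erefl)
    (@ler0c R) net orthogonal.

End RealScalarsOfC.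

(** * Real-valued seminorms and closed subspaces of finite codimension *)

Section AbsoluteValue.
Variables (R : realType) (K : numFieldType) (F : real_scalars R K).

Definition absR (a : K) : R := re F `|a|.

Lemma emb_absR a : emb F (absR a) = `|a|.
Proof. exact: emb_re. Qed.

Lemma emb_le a b : (emb F a <= emb F b) = (a <= b).
Proof. by rewrite -subr_ge0 -rmorphB emb_ge0 subr_ge0. Qed.

Lemma absR_ge0 a : 0 <= absR a.
Proof. by rewrite -(emb_ge0 F) emb_absR. Qed.

Lemma absRM a b : absR (a * b) = absR a * absR b.
Proof. by rewrite /absR -(emb_absR a) normrM -(emb_absR a) -(emb_absR b) -rmorphM !re_emb. Qed.

Lemma absRD a b : absR (a + b) <= absR a + absR b.
Proof. by rewrite -emb_le rmorphD !emb_absR ler_normD. Qed.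

Lemma absRN a : absR (- a) = absR a.
Proof. by rewrite /absR normrN. Qed.

Lemma absR0 : absR 0 = 0.
Proof. by rewrite /absR normr0 -(rmorph0 (emb F)) re_emb. Qed.

Lemma absR1 : absR 1 = 1.
Proof. by rewrite /absR normr1 -(rmorph1 (emb F)) re_emb. Qed.

Lemma absR_eq0 a : (absR a == 0) = (a == 0).
Proof.
apply/eqP/eqP => [a0|->]; last exact: absR0.
by apply/eqP; rewrite -normr_eq0 -emb_absR a0 rmorph0.
Qed.

Lemma absR_emb r : 0 <= r -> absR (emb F r) = r.
Proof. by move=> r0; rewrite /absR ger0_norm ?emb_ge0// re_emb. Qed.

Definition real_seminorm (V : lmodType K) (p : V -> R) : Prop :=
  [/\ forall x, 0 <= p x,
      forall a x, p (a *: x) = absR a * p x &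
      forall x y, p (x + y) <= p x + p y].

Section OneSeminorm.
Variables (V : lmodType K) (p : V -> R).
Hypothesis sp : real_seminorm p.

Lemma sn_ge0 x : 0 <= p x. Proof. by case: sp. Qed.
Lemma snZ a x : p (a *: x) = absR a * p x. Proof. by case: sp. Qed.
Lemma snD x y : p (x + y) <= p x + p y. Proof. by case: sp. Qed.
Lemma sn0 : p 0 = 0.
Proof. by rewrite -(scale0r 0) snZ absR0 mul0r. Qed.
Lemma snN x : p (- x) = p x.
Proof. by rewrite -scaleN1r snZ absRN absR1 mul1r. Qed.
Lemma snB x y : p (x - y) <= p x + p y.
Proof. by rewrite -(snN y) snD. Qed.
Lemma sn_distC x y : p (x - y) = p (y - x).
Proof. by rewrite -snN opprB. Qed.
Lemma sn_sum (I : Type) (s : seq I) (P : pred I) (f : I -> V) :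
  p (\sum_(i <- s | P i) f i) <= \sum_(i <- s | P i) p (f i).
Proof.
elim/big_rec2: _ => [|i a b _ ab]; first by rewrite sn0.
by rewrite (le_trans (snD _ _))// lerD2l.
Qed.
Lemma sn_le_dist x y : p x <= p y + p (x - y).
Proof. by rewrite -{1}(subrK y x) addrC snD. Qed.
End OneSeminorm.

Section Space.
Variables (V : lmodType K) (p : nat -> V -> R).
Hypothesis sp : forall j, real_seminorm (p j).
Hypothesis p_incr : forall j x, p j x <= p j.+1 x.

Lemma sn_mono i j x : (i <= j)%N -> p i x <= p j x.
Proof.
move=> /subnK <-; elim: (j - i)%N => // k ih.
exact: le_trans ih (p_incr _ _).
Qed.

(** Continuity of a seminorm f, expressed by one member of the increasing
family p. *)
Definition dominated (f : V -> R) : Prop :=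
  exists C j, 0 <= C /\ forall x, f x <= C * p j x.

Lemma dominated_sn j : dominated (p j).
Proof. by exists 1, j; split => // x; rewrite mul1r. Qed.

Lemma dominated_le f g : (forall x, f x <= g x) -> dominated g -> dominated f.
Proof.
move=> fg [C [j [C0 gC]]]; exists C, j; split => // x.
exact: le_trans (fg x) (gC x).
Qed.

Lemma dominatedD f g :
  dominated f -> dominated g -> dominated (fun x => f x + g x).
Proof.
move=> [C [i [C0 fC]]] [D [j [D0 gD]]]; exists (C + D), (maxn i j).
split=> [|x]; first exact: addr_ge0.
rewrite mulrDl lerD//.
  by apply: le_trans (fC x) _; rewrite ler_wpM2l// sn_mono// leq_maxl.
by apply: le_trans (gD x) _; rewrite ler_wpM2l// sn_mono// leq_maxr.
Qed.

Lemma dominatedZ a f : 0 <= a -> dominated f -> dominated (fun x => a * f x).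
Proof.
move=> a0 [C [j [C0 fC]]]; exists (a * C), j; split=> [|x]; first exact: mulr_ge0.
by rewrite -mulrA ler_wpM2l.
Qed.

Lemma dominated_comp f (u : V -> V) :
  dominated f -> (forall j, dominated (fun x => p j (u x))) ->
  dominated (fun x => f (u x)).
Proof.
move=> [C [j [C0 fC]]] du; apply: dominated_le (dominatedZ C0 (du j)).
by move=> x; exact: fC.
Qed.

Lemma dominated_sum n (f : nat -> V -> R) :
  (forall k, dominated (f k)) -> dominated (fun x => \sum_(k < n) f k x).
Proof.
move=> df; elim: n => [|n ih].
  by exists 0, 0%N; split => // x; rewrite big_ord0 mul0r.
by apply: dominated_le (dominatedD ih (df n)) => x; rewrite big_ord_recr.
Qed.

(** Common kernels of finitely many continuous functionals, that is, closed
subspaces of finite codimension; the inductive form gives intersections and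
finite-rank corrections by induction. *)
Inductive cofinite : set V -> Prop :=
| cofinite_setT : cofinite setT
| cofinite_ker (f : {scalar V}) (L : set V) :
    dominated (fun x => absR (f x)) -> cofinite L ->
    cofinite (L `&` [set x | f x = 0]).

Lemma cofiniteP L : cofinite L -> forall a x y, L x -> L y -> L (a *: x + y).
Proof.
elim=> // f M _ _ IH a x y [Mx fx] [My fy]; split; first exact: IH.
by rewrite /= linearP fx fy mulr0 addr0.
Qed.

Lemma cofinite0 L : cofinite L -> L 0.
Proof. by elim=> // f M _ _ M0; split => //=; rewrite linear0. Qed.

Lemma cofiniteI L M : cofinite L -> cofinite M -> cofinite (L `&` M).
Proof.
move=> cL; elim=> [|f N df cN cLN]; first by rewrite setIT.
by rewrite setIA; exact: cofinite_ker.
Qed.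

Lemma cofinite_bigI (I : eqType) (s : seq I) (L : I -> set V) :
  (forall i, cofinite (L i)) ->
  exists2 M, cofinite M & forall i, i \in s -> M `<=` L i.
Proof.
move=> cL; elim: s => [|i s [M cM Ms]]; first by exists setT => //; exact: cofinite_setT.
exists (L i `&` M); first exact: cofiniteI.
move=> k; rewrite inE => /orP[/eqP ->|/Ms Mk]; first exact: subIsetl.
by apply: subset_trans Mk; exact: subIsetr.
Qed.

(** A continuous finite-rank correction u = id - (finite rank) can push all of D
into L while staying in D: treat the functionals cutting out L one at a time,
subtracting a multiple of a vector of D on which the next functional does not
vanish. *)
Lemma cofinite_correction (D L : set V) :
  (forall a x y, D x -> D y -> D (a *: x + y)) -> cofinite L ->
  exists n (b : 'I_n -> V) (u : V -> V),
    [/\ linear u, forall x, linear_span b (x - u x),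
        forall x, D x -> D (u x) /\ L (u x) &
        forall j, dominated (fun x => p j (u x))].
Proof.
move=> DD; elim=> [|f {}L df cL [n [b [u [ul ub uD up]]]]].
  exists 0%N, (fun=> 0), id; split => //; last by move=> j; exact: dominated_sn.
  by move=> x; exists (fun=> 0); rewrite subrr big_ord0.
have [fu|] := pselect (forall x, D x -> f (u x) = 0).
  exists n, b, u; split => // x Dx; have [Du Lu] := uD x Dx.
  by split => //; split => //; exact: fu.
move=> /existsNP[a /not_implyP[Da /eqP fa0]].
have [Dua Lua] := uD a Da.
exists n.+1, (fun i => if unlift ord0 i is Some k then b k else u a).
exists (fun x => - (f (u x) / f (u a)) *: u a + u x); split.
- move=> c x y; rewrite ul linearP /= scalerDr scalerA addrACA; congr (_ + _).
  by rewrite -scalerDl; congr (_ *: _); rewrite mulrDl opprD mulrN mulrA.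
- move=> x; have [c cE] := ub x.
  exists (fun i => if unlift ord0 i is Some k then c k else f (u x) / f (u a)).
  rewrite big_ord_recl unlift_none.
  under eq_bigr do rewrite liftK.
  by rewrite -cE opprD scaleNr opprK addrCA.
- move=> x Dx; have [Dux Lux] := uD x Dx; split; first exact: DD.
  split; first exact: (cofiniteP cL).
  by rewrite /= linearP /= mulNr divfK// addNr.
- move=> j; set k := absR (f (u a))^-1 * p j (u a).
  have k0 : 0 <= k by rewrite mulr_ge0 ?absR_ge0 ?(sn_ge0 (sp j)).
  apply: dominated_le (dominatedD (dominatedZ k0 (dominated_comp df up)) (up j)).
  move=> x; apply: le_trans (snD (sp j) _ _) _; rewrite lerD2r snZ// absRN absRM.
  by rewrite [leRHS]mulrC mulrA.
Qed.

(** Otherwise p_0 vanishes on the part of D in L; with the correction u above,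
p_0(u x) vanishes for x in D, hence everywhere by density and continuity, so
that ker p_0 and the finite-dimensional range of id - u span the space. *)
Lemma cofinite_large_vector (D L : set V) :
  (forall a x y, D x -> D y -> D (a *: x + y)) -> D 0 ->
  (forall x j (eps : R), 0 < eps -> exists2 d, D d & p j (x - d) < eps) ->
  ~ finite_codimensional [set x | p 0%N x = 0] ->
  cofinite L -> exists g, [/\ D g, L g & p 0%N g = 1].
Proof.
move=> DD D0 Ddense infcodim cL; apply: contrapT => noG.
have DL0 x : D x -> L x -> p 0%N x = 0.
  move=> Dx Lx; apply: contrapT => /eqP px0; apply: noG.
  have p0 : 0 < p 0%N x by rewrite lt_def px0 (sn_ge0 (sp 0)).
  exists (emb F (p 0%N x)^-1 *: x + 0); split; [exact: DD| |].
    by apply: (cofiniteP cL) => //; exact: cofinite0.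
  by rewrite addr0 snZ// absR_emb ?invr_ge0 ?(ltW p0)// mulVf.
apply: infcodim; have [n [b [u [ul ub uD up]]]] := cofinite_correction DD cL.
exists n, b => v; exists (u v), (v - u v); split; [|exact: ub|]; last first.
  by rewrite addrC subrK.
have [C [J [C0 uC]]] := up 0%N.
apply/eqP; rewrite eq_le (sn_ge0 (sp 0)) andbT; apply/ler_addgt0Pr => e e0.
rewrite add0r.
have e1 : 0 < e / (C + 1) by rewrite divr_gt0// ltr_wpDl.
have [d Dd vd] := Ddense v J _ e1.
have [/DL0 ud0 Lud] := uD d Dd.
have -> : u v = (u (v - d)) + u d.
  have := ul 1 (v - d) d; rewrite !scale1r subrK => ->.
  by [].
apply: le_trans (snD (sp 0) _ _) _; rewrite ud0// addr0.
by apply: le_trans (uC _) _; exact: mul_le_of_lt_div.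
Qed.

(** Mazur's lemma. Each point of a finite net of the coefficient box is
orthogonal to the kernel of a functional; L is the intersection of these
kernels. The bound on the coefficients by p_0 says that h_0, ..., h_(n-1) are
independent modulo ker p_0, and makes the relevant coefficient set bounded. *)
Lemma cofinite_almost_orthogonal n (h : nat -> V) (D : R) (j : nat) : 0 <= D ->
  (forall (c : nat -> K) k, (k < n)%N ->
     absR (c k) <= D * p 0%N (\sum_(i < n) c i *: h i)) ->
  exists2 L, cofinite L & forall (c : nat -> K) g, L g ->
    p j (\sum_(i < n) c i *: h i) <= 2 * p j (\sum_(i < n) c i *: h i + g).
Proof.
move=> D0 hD; pose S := \sum_(i < n) p j (h i).
have S0 : 0 <= S by apply: sumr_ge0 => i _; exact: (sn_ge0 (sp j)).
(* With this mesh, net points approximate unit vectors up to 1/4. *)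
pose d := (4 * (S + 1))^-1.
have d0 : 0 < d by rewrite invr_gt0 mulr_gt0// ltr_wpDl.
have [s sP] := ball_net F D d0.
pose point (t : {ffun 'I_n -> 'I_(size s)}) := \sum_(i < n) s`_(t i) *: h i.
have norming t := orthogonal_functional (@sn_ge0 _ _ (sp j)) (@snZ _ _ (sp j))
  (@snD _ _ (sp j)) (point t).
have [f fP] := choice norming.
have [L cL LP] := @cofinite_bigI _ (enum {ffun 'I_n -> 'I_(size s)})
  (fun t => setT `&` [set x | f t x = 0]) (fun t => cofinite_ker
    (dominated_le (proj1 (fP t)) (dominatedZ (ler0n R 2) (dominated_sn j)))
    cofinite_setT).
exists L => // c g Lg.
set e := \sum_(i < n) c i *: h i.
have [->|e0] := eqVneq (p j e) 0; first by rewrite mulr_ge0 ?(sn_ge0 (sp j)).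
have {}e0 : 0 < p j e by rewrite lt_def e0 (sn_ge0 (sp j)).
(* Rescale so that p_j(e) = 1; the coefficients then lie in the ball of
   radius D. *)
pose l := (p j e)^-1; have l0 : 0 < l by rewrite invr_gt0.
pose c' i := emb F l * c i.
have e'E : \sum_(i < n) c' i *: h i = emb F l *: e.
  by rewrite scaler_sumr; apply: eq_bigr => i _; rewrite scalerA.
have pe' : p j (emb F l *: e) = 1.
  by rewrite snZ// absR_emb ?(ltW l0)// mulVf ?gt_eqF.
have near (i : 'I_n) : exists k : 'I_(size s), absR (c' i - s`_k) <= d.
  have [|b bs cb] := sP (c' i).
    have := hD c' i (ltn_ord i); rewrite e'E => /le_trans; apply.
    by rewrite ler_piMr// -[leRHS]pe'; exact: sn_mono.
  have ks : (index b s < size s)%N by rewrite index_mem.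
  by exists (Ordinal ks); rewrite /= nth_index.
have [t tP] := choice near.
pose T : {ffun 'I_n -> 'I_(size s)} := [ffun i => t i].
have close : p j (emb F l *: e - point T) <= 4^-1.
  rewrite -e'E /point -sumrB; apply: le_trans (sn_sum (sp j) _ _ _) _.
  apply: (@le_trans _ _ (\sum_(i < n) d * p j (h i))).
    apply: ler_sum => i _; rewrite -scalerBl snZ//.
    by rewrite ler_wpM2r ?(sn_ge0 (sp j))// ffunE.
  rewrite -mulr_sumr -/S /d invfM -mulrA ler_piMr ?invr_ge0//.
  by rewrite mulrC ler_pdivrMr ?mul1r ?ltr_wpDl// lerDl.
have LT : f T (emb F l *: g) = 0.
  by have [_ /= fg] := LP T (mem_enum _ T) _ Lg; rewrite linearZ fg /= mulr0.
have H1 := (proj2 (fP T)) _ LT.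
have H2 := sn_le_dist (sp j) (emb F l *: e) (point T).
have H3 := sn_le_dist (sp j) (point T + emb F l *: g) (emb F l *: (e + g)).
have H4 : p j (point T + emb F l *: g - emb F l *: (e + g)) <= 4^-1.
  rewrite scalerDr opprD addrACA subrr addr0 (sn_distC (sp j)).
  exact: close.
have H5 : p j (emb F l *: (e + g)) = l * p j (e + g).
  by rewrite snZ// absR_emb ?(ltW l0).
have : 1 <= 2 * (l * p j (e + g)) by lra.
by rewrite mulrCA -ler_pdivrMl// mulr1 invrK.
Qed.

End Space.
End AbsoluteValue.

(** * A block basic sequence *)

Section BasicSequence.
Variables (R : realType) (K : numFieldType) (F : real_scalars R K).
Variables (V : lmodType K) (p : nat -> V -> R).
Hypothesis sp : forall j, real_seminorm F (p j).
Hypothesis p_incr : forall j x, p j x <= p j.+1 x.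
Variable coord : nat -> {scalar V}.

Definition supported (N M : nat) (x : V) : Prop :=
  forall i, ~~ (N <= i < M)%N -> coord i x = 0.

Lemma supported0 N M : supported N M 0.
Proof. by move=> i _; rewrite linear0. Qed.

Lemma supportedP N M a x y :
  supported N M x -> supported N M y -> supported N M (a *: x + y).
Proof. by move=> sx sy i iNM; rewrite linearP /= sx// sy// mulr0 addr0. Qed.

Lemma supportedD N M x y :
  supported N M x -> supported N M y -> supported N M (x + y).
Proof. by move=> sx sy; rewrite -[x]scale1r; exact: supportedP. Qed.

Lemma supportedW N M N' M' x : (N' <= N)%N -> (M <= M')%N ->
  supported N M x -> supported N' M' x.
Proof.
move=> NN MM sx i; apply: contraNeq => ix; apply: contraR ix => /negbTE iN.
by rewrite sx//; apply: contraFN iN => /andP[Ni iM]; rewrite (leq_trans NN)// (leq_trans iM).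
Qed.

Hypothesis coord_dominated : forall i, dominated p (fun x => absR F (coord i x)).
Hypothesis poly_dense : forall x j (eps : R), 0 < eps ->
  exists M d, supported 0 M d /\ p j (x - d) < eps.
Hypothesis ker_infcodim : ~ finite_codimensional [set x | p 0%N x = 0].

(** The conditions coord i x = 0 for i < N are themselves closed conditions of
finite codimension, so late support costs nothing. *)
Lemma block_vector N L : cofinite F p L ->
  exists M g, [/\ (N < M)%N, supported N M g, L g & p 0%N g = 1].
Proof.
move=> cL.
have [L' cL' L'P] := @cofinite_bigI _ _ F _ p _ (iota 0 N)
  (fun i => setT `&` [set x | coord i x = 0])
  (fun i => cofinite_ker (coord_dominated i) (cofinite_setT F p)).
have [||x j eps e0|||g [[M gM] [Lg L'g] pg]] := @cofinite_large_vector _ _ F _ p sp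
    p_incr (fun x => exists M, supported 0 M x) (L `&` L').
- move=> a x y [M Mx] [M' M'y]; exists (maxn M M'); apply: supportedP.
    by apply: supportedW Mx => //; exact: leq_maxl.
  by apply: supportedW M'y => //; exact: leq_maxr.
- by exists 0%N; exact: supported0.
- by have [M [d [Md xd]]] := poly_dense x j e0; exists d => //; exists M.
- exact: ker_infcodim.
- exact: cofiniteI.
exists (maxn M N.+1), g; split => //; first by rewrite leq_max ltnSn orbT.
move=> i; rewrite negb_and -ltnNge => /orP[iN|iM].
  have iI : i \in iota 0 N by rewrite mem_iota.
  by have [_] := L'P i iI g L'g.
by apply: gM; apply: contra iM => /= iM; rewrite leq_max iM.
Qed.

(** E n is the span of h_0, ..., h_(n-1) and L n the closed subspace of finite
codimension from which all later vectors are taken. Stating the basic inequality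
for E n and L n makes it hold at once for every subsequence of h. *)
Lemma basic_block_sequence : exists (h : nat -> V) (M : nat -> nat)
    (E L : nat -> set V),
  [/\ forall n, (M n < M n.+1)%N /\ supported (M n) (M n.+1) (h n),
      forall n, p 0%N (h n) = 1,
      forall n a x y, (E n x -> E n y -> E n (a *: x + y)) /\
                      (L n x -> L n y -> L n (a *: x + y)),
      forall n, E n 0 /\ L n 0 &
      (forall k n, ((k < n)%N -> E n (h k)) /\ ((n <= k)%N -> L n (h k))) /\
      forall j n e g, (j <= n)%N -> E n e -> L n g -> p j e <= 2 * p j (e + g)].
Proof.
pose T := (nat * set V * (nat -> V))%type.
pose comb (s : T) n (c : nat -> K) := \sum_(k < n) c k *: s.2 k.
pose I n (s : T) := [/\ cofinite F p s.1.2,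
  exists2 D, 0 <= D & forall c k, (k < n)%N -> absR F (c k) <= D * p 0%N (comb s n c) &
  forall j c g, (j <= n)%N -> s.1.2 g ->
     p j (comb s n c) <= 2 * p j (comb s n c + g)].
pose Q n (s s' : T) := [/\ (s.1.1 < s'.1.1)%N, forall k, (k < n)%N -> s'.2 k = s.2 k,
  supported s.1.1 s'.1.1 (s'.2 n), p 0%N (s'.2 n) = 1 & s.1.2 (s'.2 n) /\ s'.1.2 `<=` s.1.2].
have [||s [_ sP]] := @invariant_dependent_choice T I Q (0%N, setT, fun=> 0).
- split; first exact: cofinite_setT.
    by exists 0.
  by move=> j c g _ _; rewrite /comb big_ord0 (sn0 (sp j)) mulr_ge0 ?(sn_ge0 (sp j)).
- move=> n [[N L] h] [/= cL [D D0 hD] Lorth].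
  have [N' [g [NN' gN' Lg pg]]] := block_vector N cL.
  pose h' (k : nat) := if k == n then g else h k.
  have combS (c : nat -> K) : \sum_(k < n.+1) c k *: h' k = \sum_(k < n) c k *: h k + c n *: g.
    rewrite big_ord_recr /= /h' eqxx; congr (_ + _).
    by apply: eq_bigr => k _; rewrite ltn_eqF.
  have old (c : nat -> K) : p 0%N (\sum_(k < n) c k *: h k) <=
      2 * p 0%N (\sum_(k < n.+1) c k *: h' k).
    rewrite combS; apply: Lorth => //.
    by rewrite -[_ *: g]addr0; apply: (cofiniteP cL) => //; exact: cofinite0 cL.
  have coef (c : nat -> K) k : (k < n.+1)%N ->
      absR F (c k) <= (2 * D + 3) * p 0%N (\sum_(k < n.+1) c k *: h' k).
    have P0 := sn_ge0 (sp 0) (\sum_(k < n.+1) c k *: h' k).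
    rewrite ltnS leq_eqVlt => /orP[/eqP ->|kn].
      have -> : absR F (c n) = p 0%N (c n *: g) by rewrite (snZ (sp 0)) pg mulr1.
      have -> : c n *: g = \sum_(k < n.+1) c k *: h' k - \sum_(k < n) c k *: h k.
        by rewrite combS addrC addKr.
      have := snB (sp 0) (\sum_(k < n.+1) c k *: h' k) (\sum_(k < n) c k *: h k).
      have := old c; have := mulr_ge0 D0 P0; lra.
    have := hD c k kn; have := ler_wpM2l D0 (old c); rewrite /comb /=; lra.
  (* One constraint for each seminorm p_j with j <= n+1. *)
  have DD : 0 <= 2 * D + 3 by lra.
  have almost j := cofinite_almost_orthogonal sp p_incr j DD coef.
  have /choice[Lj LjP] : forall j, exists M : set V, cofinite F p M /\
      forall (c : nat -> K) g, M g -> p j (\sum_(i < n.+1) c i *: h' i) <=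
        2 * p j (\sum_(i < n.+1) c i *: h' i + g).
    by move=> j; have [M cM MP] := almost j; exists M.
  have [L' cL' L'P] := cofinite_bigI (iota 0 n.+2) (fun j => proj1 (LjP j)).
  exists (N', L `&` L', h'); split; split => //=.
  - exact: cofiniteI.
  - by exists (2 * D + 3).
  - move=> j c g' jn [_ L'g']; apply: (proj2 (LjP j)); apply: L'P => //.
    by rewrite mem_iota.
  - by move=> k kn; rewrite /h' ltn_eqF.
  - by rewrite /h' eqxx.
  - by rewrite /h' eqxx.
  - by rewrite /h' eqxx; split => //; exact: subIsetl.
pose h k := (s k.+1).2 k.
have hE n k : (k < n)%N -> (s n).2 k = h k.
  elim: n => // n ih; rewrite ltnS leq_eqVlt => /orP[/eqP ->//|kn].
  by have [_ [_ + _ _ _]] := sP n; move=> ->//; exact: ih.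
have Lmono n k : (n <= k)%N -> (s k).1.2 `<=` (s n).1.2.
  move=> /subnK <-; elim: (k - n)%N => // i ih.
  by have [_ [_ _ _ _ [_ +]]] := sP (i + n)%N; move/subset_trans; apply.
exists h, (fun n => (s n).1.1),
  (fun n => [set x | exists c : nat -> K, x = \sum_(k < n) c k *: h k]),
  (fun n => (s n).1.2); split.
- by move=> n; have [_ []] := sP n.
- by move=> n; have [_ []] := sP n.
- move=> n a x y; split; last first.
    by have [[cL _ _] _] := sP n => Lx Ly; exact: (cofiniteP cL).
  move=> [c ->] [d ->]; exists (fun k => a * c k + d k).
  rewrite scaler_sumr -big_split; apply: eq_bigr => k _ /=.
  by rewrite scalerDl scalerA.
- move=> n; split; last by have [[cL _ _] _] := sP n; exact: cofinite0 cL.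
  by exists (fun=> 0); rewrite big1// => k _; rewrite scale0r.
split.
  move=> k n; split => [kn|nk].
    exists (fun i => (i == k)%:R); rewrite (bigD1 (Ordinal kn))//= eqxx scale1r.
    by rewrite big1 ?addr0// => i; rewrite -val_eqE /= => /negbTE ->; rewrite scale0r.
  by apply: (Lmono _ _ nk); have [_ [_ _ _ _ []]] := sP k.
move=> j n _ g jn [c ->] Lg; have [[_ _ +] _] := sP n => /(_ j c g jn Lg).
by rewrite /comb; under eq_bigr => k _ do rewrite hE//.
Qed.

End BasicSequence.

(** * Assembling the universal blocks *)

(** The size allowed to corrections of stage s. The factor 4^s beats the number
s+1 of corrections made at that stage, and 32 keeps the perturbation of a
combination of the basic sequence below half of its seminorm p_0. *)
Definition block_error (R : realType) (s : nat) : R := (32 * 4 ^+ s)^-1.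

Lemma block_error_gt0 (R : realType) s : 0 < block_error R s.
Proof. by rewrite invr_gt0 mulr_gt0// exprn_gt0. Qed.

Lemma block_errorS (R : realType) s : block_error R s.+1 = block_error R s / 4.
Proof. by rewrite /block_error exprSr mulrA invfM. Qed.

Lemma block_error_le (R : realType) s t : (s <= t)%N ->
  block_error R t <= block_error R s.
Proof.
move=> /subnK <-; elim: (t - s)%N => // k ih; apply: le_trans ih.
rewrite addSn block_errorS; have := block_error_gt0 R (k + s); lra.
Qed.

Lemma block_error_small (R : realType) s : s.+1%:R * block_error R s <= s.+1%:R^-1.
Proof.
have H : s.+1%:R ^+ 2 <= 4 ^+ s * 4 :> R.
  rewrite -exprSr (_ : 4 = 2 ^+ 2) -?exprM; last by rewrite -natrX.
  rewrite mulnC exprM lerXn2r ?nnegrE ?exprn_ge0// -natrX ler_nat.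
  exact: ltnW (ltn_expl _ _).
have s0 : 0 < s.+1%:R :> R by [].
rewrite -ler_pdivlMl// -invfM /block_error lef_pV2 ?posrE ?mulr_gt0 ?exprn_gt0//.
by rewrite -expr2; apply: le_trans H _; rewrite mulrC ler_wpM2r ?exprn_ge0// ler_nat.
Qed.

Lemma strict_incr_ge (N : nat -> nat) :
  (forall s, (N s < N s.+1)%N) -> forall s, (N 0 + s <= N s)%N.
Proof.
by move=> Nlt; elim=> [|s ih]; rewrite ?addn0// addnS (leq_ltn_trans ih).
Qed.

Lemma strict_incr_mono (N : nat -> nat) :
  (forall s, (N s < N s.+1)%N) -> {mono N : i j / (i <= j)%N}.
Proof. by move=> Nlt; apply: leq_mono; apply: (homo_ltn ltn_trans). Qed.

Section BlockFamily.
Variables (R : realType) (K : numFieldType) (F : real_scalars R K).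
Variables (V : lmodType K) (p : nat -> V -> R).
Hypothesis sp : forall j, real_seminorm F (p j).
Hypothesis p_incr : forall j x, p j x <= p j.+1 x.
Variable coord : nat -> {scalar V}.
Hypothesis coord_dominated : forall i, dominated p (fun x => absR F (coord i x)).
Hypothesis coord_inj : forall a, (forall i, coord i a = 0) -> a = 0.
Hypothesis complete : forall u : nat -> V,
  (forall j (e : R), 0 < e -> exists n, forall i k, (n <= i)%N -> (n <= k)%N ->
      p j (u i - u k) < e) ->
  exists l, forall j (e : R), 0 < e -> exists n, forall i, (n <= i)%N ->
      p j (u i - l) < e.

Variables (X : lmodType K) (q : nat -> X -> R).
Variable x : nat -> X.

Definition initial_sum (M : nat) (a : V) : X := \sum_(i < M) coord i a *: x i.

Lemma initial_sumP M : linear (initial_sum M).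
Proof.
move=> a y z; rewrite /initial_sum scaler_sumr -big_split.
by apply: eq_bigr => i _; rewrite /= linearP scalerDl scalerA.
Qed.

Lemma initial_sumD M a b : initial_sum M (a + b) = initial_sum M a + initial_sum M b.
Proof. by have := initial_sumP M 1 a b; rewrite !scale1r. Qed.

(** A polynomial has the same partial sums from the end of its support on, so
that blocks ending at different places can be evaluated at a common index. *)
Lemma initial_sum_stable M N a : supported coord 0 M a -> (M <= N)%N ->
  initial_sum N a = initial_sum M a.
Proof.
move=> sa MN; rewrite /initial_sum (big_ord_widen (n1 := M) N (fun i => coord i a *: x i))//.
rewrite [RHS]big_mkcond; apply: eq_bigr => i _; case: ifP => //= iM.
by rewrite sa ?scale0r// iM.
Qed.

Hypothesis universal_block : forall N j (e : R) y, 0 < e -> exists M b,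
  [/\ supported coord N M b, p j b < e & q j (initial_sum M b - y) < e].

Variables (h : nat -> V) (Mh : nat -> nat).
Hypothesis h_supp : forall n, supported coord (Mh n) (Mh n.+1) (h n).
Hypothesis Mh_lt : forall n, (Mh n < Mh n.+1)%N.
Hypothesis h1 : forall n, p 0%N (h n) = 1.
Variable target : nat -> nat -> X.

Local Notation eps := (block_error R).

(** v s k is the part of u_k built before stage s, and N s bounds its support. At
stage s the basic vector h (N s) is used to start u_s; since supports of h move
to the right by at least one at each step, h (N s) starts after all earlier
blocks. Then every u_k with k <= s gets a universal block b which moves its
partial sum at N (s+1) to the target. *)
Lemma block_stages : exists (N : nat -> nat) (v : nat -> nat -> V),
  [/\ forall s, (Mh (N s).+1 <= N s.+1)%N,
      forall s k, supported coord 0 (N s) (v s k),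
      forall s k, (s <= k)%N -> v s k = 0,
      forall s k, (k <= s)%N ->
        exists b, [/\ v s.+1 k = v s k + (if k == s then h (N s) else 0) + b,
          supported coord (Mh (N s).+1) (N s.+1) b & p s b < eps s] &
      forall s k, (k <= s)%N ->
        q s (initial_sum (N s.+1) (v s.+1 k) - target s k) < eps s].
Proof.
pose T := (nat * (nat -> V))%type.
pose I s (t : T) := (forall k, supported coord 0 t.1 (t.2 k)) /\
  forall k, (s <= k)%N -> t.2 k = 0.
pose base s (t : T) k := t.2 k + (if k == s then h t.1 else 0).
pose Q s (t t' : T) := [/\ (Mh t.1.+1 <= t'.1)%N,
  forall k, (k <= s)%N -> exists b, [/\ t'.2 k = base s t k + b,
    supported coord (Mh t.1.+1) t'.1 b & p s b < eps s] &
  forall k, (k <= s)%N -> q s (initial_sum t'.1 (t'.2 k) - target s k) < eps s].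
have MhN n : (n <= Mh n)%N.
  by apply: leq_trans (strict_incr_ge Mh_lt n); rewrite leq_addl.
have [||st [st0 stP]] := @invariant_dependent_choice T I Q (0%N, fun=> 0).
- by split => // k; exact: supported0.
- move=> s t [tsupp tz].
  have bsupp k : supported coord 0 (Mh t.1.+1) (base s t k).
    apply: supportedD.
      apply: supportedW (tsupp k) => //.
      exact: leq_trans (leqnSn _) (MhN _).
    case: eqP => _; last exact: supported0.
    by apply: supportedW (@h_supp t.1).
  have /choice[Mb MbP] : forall k, exists Mb : nat * V,
      [/\ supported coord (Mh t.1.+1) Mb.1 Mb.2, p s Mb.2 < eps s &
        q s (initial_sum Mb.1 Mb.2 -
          (target s k - initial_sum (Mh t.1.+1) (base s t k))) < eps s].
    move=> k; have [M [b Hb]] := universal_block (Mh t.1.+1) s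
      (target s k - initial_sum (Mh t.1.+1) (base s t k)) (block_error_gt0 R s).
    by exists (M, b).
  pose N' := maxn (Mh t.1.+1) (\max_(k < s.+1) (Mb k).1).
  have N'k k : (k <= s)%N -> ((Mb k).1 <= N')%N.
    rewrite -ltnS => ks; rewrite leq_max; apply/orP; right.
    exact: (leq_bigmax (Ordinal ks)).
  have N'M : (Mh t.1.+1 <= N')%N by exact: leq_maxl.
  exists (N', fun k => if (k <= s)%N then base s t k + (Mb k).2 else t.2 k).
  split; split => //=.
  + move=> k; case: leqP => ks.
      have [sb _ _] := MbP k; apply: supportedD; first exact: supportedW (bsupp k).
      by apply: supportedW sb => //; exact: N'k.
    by apply: supportedW (tsupp k) => //; rewrite (leq_trans _ N'M)// (leq_trans _ (MhN _)).
  + by move=> k sk; rewrite leqNgt sk /=; apply: tz; exact: ltnW.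
  + move=> k ks; rewrite ks; exists (Mb k).2; have [sb pb _] := MbP k.
    by split => //; apply: supportedW sb => //; exact: N'k.
  + move=> k ks; rewrite ks; have [sb _ qb] := MbP k.
    rewrite initial_sumD (initial_sum_stable (bsupp k) N'M).
    rewrite (@initial_sum_stable (Mb k).1 N') ?N'k//; last exact: supportedW sb.
    by move: qb; rewrite opprB addrA (addrC (initial_sum (Mb k).1 _)).
exists (fun s => (st s).1), (fun s => (st s).2); split.
- by move=> s; have [_ [? _ _]] := stP s.
- by move=> s; have [[? _] _] := stP s.
- by move=> s; have [[_ ?] _] := stP s.
- by move=> s k ks; have [_ [_ + _]] := stP s; move=> /(_ k ks).
- by move=> s; have [_ [_ _ ?]] := stP s.
Qed.

(** Passage to the limits u_k of v s k. The index d k lies in the support of the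
starting vector of u_k, which no other block meets; so coordinate d k reads off
the coefficient of u_k in any combination. *)
Lemma block_family : exists (N : nat -> nat) (v : nat -> nat -> V) (u : nat -> V)
    (d : nat -> nat),
  [/\ forall s, (N s < N s.+1)%N,
      (forall k j, (j <= k)%N -> p j (u k - h (N k)) <= 2 * eps k) /\
      (forall s k j, (j <= s)%N -> (k < s)%N -> p j (u k - v s k) <= 2 * eps s),
      (forall s k i, (i < N s)%N -> coord i (u k) = coord i (v s k)) /\
      (forall s k, supported coord 0 (N s) (v s k) /\ ((s <= k)%N -> v s k = 0)),
      forall s k, (k <= s)%N ->
        q s (initial_sum (N s.+1) (v s.+1 k) - target s k) < eps s &
      forall k l, (coord (d k) (u l) == 0) = (l != k)].
Proof.
have [N [v [NP vsupp v0 vS vq]]] := block_stages.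
have MhN n : (n <= Mh n)%N.
  by apply: leq_trans (strict_incr_ge Mh_lt n); rewrite leq_addl.
have Nlt s : (N s < N s.+1)%N.
  by apply: leq_trans (NP s); rewrite (leq_trans _ (MhN _)).
have Nmono := strict_incr_mono Nlt.
have vcauchy s j k n : (j <= s)%N -> (k < s)%N ->
    p j (v (n + s)%N k - v s k) <= 2 * eps s - 2 * eps (n + s)%N.
  move=> js ks; elim: n => [|n ih]; first by rewrite !subrr (sn0 (sp j)).
  have kns : (k < n + s)%N by rewrite (leq_trans ks)// leq_addl.
  have [b [vE _ pb]] := vS (n + s)%N k (ltnW kns).
  rewrite addSn vE ltn_eqF// addr0 addrAC block_errorS.
  have := snD (sp j) (v (n + s)%N k - v s k) b.
  have pjb : p j b <= p (n + s)%N b.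
    by apply: (sn_mono p_incr); rewrite (leq_trans js)// leq_addl.
  have := block_error_gt0 R (n + s)%N; lra.
have vcauchy' s j k n : (j <= s)%N -> (k < s)%N -> (s <= n)%N ->
    p j (v n k - v s k) <= 2 * eps s.
  move=> js ks /subnK <-; apply: le_trans (vcauchy _ _ _ _ js ks) _.
  by rewrite gerBl mulr_ge0// ltW// block_error_gt0.
have eps_small e : 0 < e -> exists s0, forall s, (s0 <= s)%N -> eps s < e.
  move=> e0; exists (Num.truncn e^-1) => s es.
  apply: (@le_lt_trans _ _ s.+1%:R^-1).
    apply: le_trans (block_error_small R s); rewrite ler_peMl// ?ler1n//.
    exact/ltW/block_error_gt0.
  exact: invS_lt.
have /choice[u uP] : forall k, exists l, forall j (e : R), 0 < e ->
    exists n, forall i, (n <= i)%N -> p j (v i k - l) < e.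
  move=> k; apply: complete => j e e0.
  have e4 : 0 < e / 4 by lra.
  have [s0 s0P] := eps_small _ e4.
  pose s := maxn s0 (maxn j k.+1).
  have es : eps s < e / 4 by apply: s0P; exact: leq_maxl.
  have js : (j <= s)%N by rewrite !leq_max leqnn !orbT.
  have ks : (k < s)%N by rewrite !leq_max ltnSn !orbT.
  exists s => i l si sl.
  have := vcauchy' _ _ _ _ js ks si; have := vcauchy' _ _ _ _ js ks sl.
  have := snB (sp j) (v i k - v s k) (v l k - v s k).
  by rewrite opprB addrA subrK; lra.
have uv s k j : (j <= s)%N -> (k < s)%N -> p j (u k - v s k) <= 2 * eps s.
  move=> js ks; apply/ler_addgt0Pr => e e0; have [n nP] := uP k j e e0.
  have := nP (maxn n s) (leq_maxl _ _).
  have := vcauchy' _ _ _ _ js ks (leq_maxr n s).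
  have := snB (sp j) (v (maxn n s) k - v s k) (v (maxn n s) k - u k).
  rewrite opprB [_ + (u k - _)]addrC addrA subrK; lra.
have vcoord s k i n : (i < N s)%N -> coord i (v (n + s)%N k) = coord i (v s k).
  move=> iN; elim: n => // n ih.
  have iN' : (i < N (n + s))%N by rewrite (leq_trans iN)// Nmono leq_addl.
  have [kns|kns] := leqP k (n + s); last by rewrite -ih !v0// ltnW.
  have [b [vE sb _]] := vS (n + s)%N k kns.
  rewrite addSn vE !linearD /= ih [X in _ + X]sb ?addr0; last first.
    by rewrite negb_and -ltnNge (leq_trans iN')// (leq_trans _ (MhN _)).
  case: eqP => _; last by rewrite linear0 addr0.
  by rewrite h_supp ?addr0// negb_and -ltnNge (leq_trans iN')// MhN.
have ucoord s k i : (i < N s)%N -> coord i (u k) = coord i (v s k).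
  move=> iN; apply/eqP; rewrite -subr_eq0 -(absR_eq0 F).
  rewrite eq_le absR_ge0 andbT; apply/ler_addgt0Pr => e e0; rewrite add0r.
  have [C [J [C0 cJ]]] := coord_dominated i.
  have e1 : 0 < e / (C + 1) by rewrite divr_gt0// ltr_wpDl.
  have [n nP] := uP k J _ e1.
  have ns : (n <= n + s)%N by rewrite leq_addr.
  rewrite -(vcoord s k i n iN) -linearB /=.
  apply: le_trans (cJ _) _; rewrite (sn_distC (sp J)).
  by apply: mul_le_of_lt_div => //; exact: nP.
have /choice[d dP] : forall k, exists d, coord d (h (N k)) != 0.
  move=> k; apply: contrapT => /forallNP nd.
  have : h (N k) = 0 by apply: coord_inj => i; apply/eqP/negPn/negP; exact: nd.
  by move=> h0; have := h1 (N k); rewrite h0 (sn0 (sp 0)) => /esym/eqP; rewrite oner_eq0.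
have dN k : (Mh (N k) <= d k < Mh (N k).+1)%N.
  by apply: contra_neqT (dP k); exact: h_supp.
have coordS k : coord (d k) (v k.+1 k) = coord (d k) (h (N k)).
  have /andP[_ d2] := dN k.
  have [b [-> sb _]] := vS k k (leqnn k); rewrite v0// eqxx add0r linearD /=.
  by rewrite [X in _ + X]sb ?addr0// negb_and -ltnNge d2.
exists N, v, u, d; split => //.
- split => // k j jk; have [b [vE _ pb]] := vS k k (leqnn k).
  have H1 := uv k.+1 k j (leqW jk) (ltnSn k).
  have H2 := sn_mono p_incr b jk.
  move: vE; rewrite eqxx (v0 k k)// add0r => vE.
  have -> : u k - h (N k) = (u k - v k.+1 k) + b.
    by rewrite vE opprD addrA subrK.
  have := snD (sp j) (u k - v k.+1 k) b; move: H1; rewrite block_errorS.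
  have := block_error_gt0 R k; lra.
- by split => // s k; split => //; exact: v0.
move=> k l; have /andP[d1 d2] := dN k.
have dNS : (d k < N k.+1)%N by apply: leq_trans d2 _; exact: NP.
rewrite (ucoord k.+1)//; have [->|lk] /= := eqVneq l k.
  by rewrite coordS; exact/negbTE.
apply/eqP; have [kl|lk'] := leqP k.+1 l; first by rewrite v0// linear0.
have [b [-> sb _]] := vS k l lk'; rewrite (negbTE lk) addr0 linearD /=.
rewrite [X in _ + X]sb ?addr0; last by rewrite negb_and -ltnNge d2.
by apply: vsupp; rewrite /= -leqNgt (leq_trans _ d1).
Qed.

End BlockFamily.

(** * Closed spans of perturbed basic sequences *)

Lemma block_error_sum (R : realType) m : \sum_(k < m) block_error R k <= 16^-1.
Proof.
suff: \sum_(k < m) block_error R k <= 2 * block_error R 0 - 2 * block_error R m.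
  have -> : block_error R 0 = 32^-1 by rewrite /block_error expr0 mulr1.
  have := block_error_gt0 R m; lra.
elim: m => [|m ih]; first by rewrite big_ord0 subrr.
rewrite big_ord_recr /= block_errorS; have := block_error_gt0 R m; lra.
Qed.

Lemma partial_sums_mono (R : realType) (f : nat -> R) i m :
  (forall k, 0 <= f k) -> (i <= m)%N -> \sum_(k < i) f k <= \sum_(k < m) f k.
Proof.
move=> f0 /subnK <-; elim: (m - i)%N => // k ih.
by rewrite addSn big_ord_recr /= (le_trans ih)// lerDl.
Qed.

Section PerturbedBasis.
Variables (R : realType) (K : numFieldType) (F : real_scalars R K).
Variables (V : lmodType K) (p : nat -> V -> R).
Hypothesis sp : forall j, real_seminorm F (p j).
Hypothesis p_incr : forall j x, p j x <= p j.+1 x.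

Lemma real_seminorm0 : real_seminorm F (fun _ : V => 0).
Proof. by split => // *; rewrite ?mulr0 ?addr0. Qed.

Lemma real_seminorm_scalar (f : V -> K) :
  scalar f -> real_seminorm F (fun x => absR F (f x)).
Proof.
move=> fl; split=> [x|a x|x y]; first exact: absR_ge0.
  have := fl a x 0; have := fl (-1) 0 0.
  by rewrite scaler0 !addr0 mulN1r addNr => -> ->; rewrite addr0 absRM.
by have := fl 1 x y; rewrite scale1r mul1r => ->; exact: absRD.
Qed.

Lemma real_seminorm_comp j (f : V -> V) :
  linear f -> real_seminorm F (fun x => p j (f x)).
Proof.
move=> fl; split=> [x|a x|x y]; first exact: (sn_ge0 (sp j)).
  have := fl a x 0; have := fl (-1) 0 0.
  by rewrite scaler0 !addr0 scaleN1r addNr => -> ->; rewrite addr0 (snZ (sp j)).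
by have := fl 1 x y; rewrite !scale1r => ->; exact: (snD (sp j)).
Qed.

Lemma real_seminormZ a (f : V -> R) : 0 <= a -> real_seminorm F f ->
  real_seminorm F (fun x => a * f x).
Proof.
move=> a0 sf; split=> [x|b x|x y]; first by rewrite mulr_ge0// (sn_ge0 sf).
  by rewrite (snZ sf) mulrCA.
by rewrite -mulrDr ler_wpM2l// (snD sf).
Qed.

Definition sn_closure (D : set V) : set V :=
  [set z | forall j (e : R), 0 < e -> exists2 w, D w & p j (z - w) < e].

Lemma sn_closure_le (D : set V) (f g : V -> R) :
  real_seminorm F f -> real_seminorm F g -> dominated p f -> dominated p g ->
  (forall w, D w -> f w <= g w) -> forall z, sn_closure D z -> f z <= g z.
Proof.
move=> sf sg df dg fg z Wz; apply/ler_addgt0Pr => e e0.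
have [C [J [C0 CJ]]] := dominatedD p_incr df dg.
have e1 : 0 < e / (C + 1) by rewrite divr_gt0// ltr_wpDl.
have [w Dw zw] := Wz J _ e1.
have := fg w Dw; have := sn_le_dist sf z w; have := sn_le_dist sg w z.
rewrite (sn_distC sg).
suff : f (z - w) + g (z - w) <= e by lra.
by apply: le_trans (CJ _) _; exact: mul_le_of_lt_div.
Qed.

Lemma sn_closureP (D : set V) :
  (forall a x y, D x -> D y -> D (a *: x + y)) ->
  forall a x y, sn_closure D x -> sn_closure D y -> sn_closure D (a *: x + y).
Proof.
move=> DD a x y Wx Wy j e e0; have a0 := absR_ge0 F a.
have e1 : 0 < e / 2 / (absR F a + 1) by rewrite !divr_gt0// ltr_wpDl.
have e2 : 0 < e / 2 by rewrite divr_gt0.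
have [w Dw xw] := Wx j _ e1; have [w' Dw' yw'] := Wy j _ e2.
exists (a *: w + w'); first exact: DD.
rewrite opprD addrACA -scalerBr; apply: le_lt_trans (snD (sp j) _ _) _.
rewrite (snZ (sp j)) (splitr e) ler_ltD//.
exact: mul_le_of_lt_div.
Qed.

Variables (g u : nat -> V) (coef : nat -> V -> K).
Hypothesis g_basic : forall j i m (c : nat -> K), (j <= i)%N -> (i <= m)%N ->
  p j (\sum_(k < i) c k *: g k) <= 2 * p j (\sum_(k < m) c k *: g k).
Hypothesis g1 : forall k, p 0%N (g k) = 1.
Hypothesis ug : forall k j, (j <= k)%N -> p j (u k - g k) <= 2 * block_error R k.
Hypothesis coef_scalar : forall k, scalar (coef k).
Hypothesis coef_dominated : forall k, dominated p (fun x => absR F (coef k x)).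
Hypothesis coef_u : forall k l, coef k (u l) = (l == k)%:R.

Local Notation combg c m := (\sum_(k < m) c k *: g k).
Local Notation combu c m := (\sum_(k < m) c k *: u k).

Lemma perturbation_le j (c : nat -> K) m B :
  (forall k, (k < m)%N -> absR F (c k) <= B) ->
  p j (combu c m - combg c m) <= B * \sum_(k < m) p j (u k - g k).
Proof.
move=> cB; rewrite -sumrB mulr_sumr; apply: le_trans (sn_sum (sp j) _ _ _) _.
apply: ler_sum => k _; rewrite -scalerBr (snZ (sp j)).
by rewrite ler_wpM2r ?(sn_ge0 (sp j))// cB.
Qed.

(** For the basic sequence g, the coefficients are at most 4 p_0 of the sum. The
perturbation is then at most half of p_0 of the sum, which costs another factor
2. *)
Lemma combu_coef_le (c : nat -> K) m k : (k < m)%N ->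
  absR F (c k) <= 8 * p 0%N (combu c m).
Proof.
move=> km.
have cg l : (l < m)%N -> absR F (c l) <= 4 * p 0%N (combg c m).
  move=> lm; have -> : absR F (c l) = p 0%N (c l *: g l).
    by rewrite (snZ (sp 0)) g1 mulr1.
  have -> : c l *: g l = combg c l.+1 - combg c l by rewrite big_ord_recr addrC addKr.
  have := snB (sp 0) (combg c l.+1) (combg c l).
  have := g_basic c (leq0n l.+1) lm; have := g_basic c (leq0n l) (ltnW lm); lra.
have := perturbation_le 0 cg.
have G0 := sn_ge0 (sp 0) (combg c m).
have sum_small : \sum_(k < m) p 0%N (u k - g k) <= 8^-1.
  apply: (@le_trans _ _ (\sum_(k < m) 2 * block_error R k)).
    by apply: ler_sum => i _; exact: ug.
  by rewrite -mulr_sumr; have := block_error_sum R m; lra.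
have := ler_wpM2l G0 sum_small.
have := sn_le_dist (sp 0) (combg c m) (combu c m).
by rewrite (sn_distC (sp 0)) => H1 H2 H3; have := cg k km; lra.
Qed.

(** For i >= j this is the basic inequality for g plus the perturbation; for
i < j there are only finitely many vectors, and the bound on the coefficients
suffices. *)
Lemma combu_projection_le j : exists2 C, 0 <= C & forall (c : nat -> K) i m,
  (i <= m)%N -> p j (combu c i) <= C * p j (combu c m).
Proof.
pose P k := p j (u k - g k); have P0 k : 0 <= P k by exact: (sn_ge0 (sp j)).
pose S := \sum_(k < j) P k + 8^-1.
have S0 : 0 <= S by rewrite addr_ge0 ?sumr_ge0.
have PS m : \sum_(k < m) P k <= S.
  suff : \sum_(k < m) P k <= \sum_(k < j) P k + \sum_(k < m) 2 * block_error R k.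
    by rewrite -mulr_sumr /S; have := block_error_sum R m; lra.
  elim: m => [|m ih]; first by rewrite !big_ord0 addr0 sumr_ge0.
  have [jm|mj] := leqP j m.
    by rewrite !big_ord_recr /= addrA lerD//; exact: ug.
  apply: le_trans (partial_sums_mono P0 mj) _; rewrite lerDl sumr_ge0// => k _.
  by rewrite mulr_ge0// ltW// block_error_gt0.
pose G := \sum_(k < j) p j (g k).
have G0 : 0 <= G by apply: sumr_ge0 => k _; exact: (sn_ge0 (sp j)).
exists (2 + 24 * S + 8 * G) => [|c i m im]; first by lra.
pose B := 8 * p j (combu c m).
have B0 : 0 <= B by rewrite mulr_ge0// (sn_ge0 (sp j)).
have cB k : (k < m)%N -> absR F (c k) <= B.
  move=> /(combu_coef_le c) /le_trans; apply.
  by rewrite ler_wpM2l// (sn_mono p_incr).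
have cBi k : (k < i)%N -> absR F (c k) <= B by move=> ki; apply: cB; exact: leq_trans im.
have H1 := perturbation_le j cB; have H2 := perturbation_le j cBi.
have H3 := ler_wpM2l B0 (PS m); have H4 := ler_wpM2l B0 (PS i).
have H5 := sn_le_dist (sp j) (combg c m) (combu c m).
have H6 := sn_le_dist (sp j) (combu c i) (combg c i).
rewrite (sn_distC (sp j)) in H5.
have BG : 0 <= B * G by rewrite mulr_ge0.
have BE : (2 + 24 * S + 8 * G) * p j (combu c m)
  = 2 * p j (combu c m) + 3 * (B * S) + B * G by rewrite /B; ring.
rewrite BE {BE}; have BS : 0 <= B * S by rewrite mulr_ge0.
have U0 := sn_ge0 (sp j) (combu c m).
have [ji|ij] := leqP j i.
  have H7 := g_basic c ji im; rewrite /P in H3 H4; lra.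
have H7 : p j (combg c i) <= B * G.
  apply: (@le_trans _ _ (B * \sum_(k < i) p j (g k))).
    rewrite mulr_sumr; apply: le_trans (sn_sum (sp j) _ _ _) _.
    by apply: ler_sum => k _; rewrite (snZ (sp j)) ler_wpM2r ?cBi// (sn_ge0 (sp j)).
  rewrite ler_wpM2l//; apply: (@partial_sums_mono _ (fun k => p j (g k)) i j _ (ltnW ij)) => k.
  exact: (sn_ge0 (sp j)).
rewrite /P in H3 H4; lra.
Qed.

Definition expansion i (z : V) : V := \sum_(k < i) coef k z *: u k.

(** The linear span of u, described by the coefficient functionals: no
coefficients have to be chosen, and linearity is immediate. *)
Definition finite_expansions : set V :=
  [set w | exists m, forall i, (m <= i)%N -> expansion i w = w].

Definition basic_span : set V := sn_closure finite_expansions.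

Lemma expansion_linear i : linear (expansion i).
Proof.
move=> a y z; rewrite /expansion scaler_sumr -big_split.
by apply: eq_bigr => k _; rewrite /= coef_scalar scalerDl scalerA.
Qed.

Lemma dominated_coefZ j k w : dominated p (fun z => p j (coef k z *: w)).
Proof.
have w0 := sn_ge0 (sp j) w.
apply: dominated_le (dominatedZ w0 (coef_dominated k)) => z.
by rewrite (snZ (sp j)) mulrC.
Qed.

Lemma dominated_expansion j i (w : nat -> V) :
  dominated p (fun z => p j (\sum_(k < i) coef k z *: w k)).
Proof.
apply: dominated_le (dominated_sum p_incr i (fun k => dominated_coefZ j k (w k))).
by move=> z; exact: (sn_sum (sp j)).
Qed.

Lemma finite_expansionsP a x y : finite_expansions x -> finite_expansions y ->
  finite_expansions (a *: x + y).
Proof.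
move=> [m mx] [n ny]; exists (maxn m n) => i; rewrite geq_max => /andP[mi ni].
by rewrite expansion_linear mx// ny.
Qed.

Lemma finite_expansions_basis k : finite_expansions (u k).
Proof.
exists k.+1 => i ki; rewrite /expansion (bigD1 (Ordinal ki))//= coef_u eqxx scale1r.
rewrite big1 ?addr0// => l; rewrite -val_eqE /= => lk.
by rewrite coef_u eq_sym (negbTE lk) scale0r.
Qed.

Lemma basic_spanP a x y : basic_span x -> basic_span y -> basic_span (a *: x + y).
Proof. exact/sn_closureP/finite_expansionsP. Qed.

Lemma basic_span_basis k : basic_span (u k).
Proof.
move=> j e e0; exists (u k); first exact: finite_expansions_basis.
by rewrite subrr (sn0 (sp j)).
Qed.

Lemma basic_span_coef_le z k : basic_span z -> absR F (coef k z) <= 8 * p 0%N z.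
Proof.
apply: (sn_closure_le (f := fun z => absR F (coef k z)) (g := fun z => 8 * p 0%N z)).
- exact: real_seminorm_scalar.
- exact: real_seminormZ.
- exact: coef_dominated.
- exact: dominatedZ (dominated_sn p 0).
move=> w [m mw]; have := combu_coef_le (fun k => coef k w) (leq_maxr m k.+1).
by rewrite -/(expansion _ w) mw// leq_maxl.
Qed.

(** The partial expansions are equicontinuous on the finite combinations, hence
on their closure, and they are eventually the identity on each finite
combination. *)
Lemma basic_span_expansion z j e : basic_span z -> 0 < e ->
  exists i0, forall i, (i0 <= i)%N -> p j (z - expansion i z) < e.
Proof.
move=> Wz e0; have [C C0 CP] := combu_projection_le j.
have CW i y : basic_span y -> p j (expansion i y) <= C * p j y.
  apply: (sn_closure_le (f := fun y => p j (expansion i y)) (g := fun y => C * p j y)).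
  - exact: real_seminorm_comp (expansion_linear i).
  - exact: real_seminormZ.
  - exact: dominated_expansion.
  - exact: dominatedZ (dominated_sn p j).
  move=> w [m mw]; have := CP (fun k => coef k w) i _ (leq_maxr m i).
  by rewrite -!/(expansion _ w) (mw (maxn m i))// leq_maxl.
have e1 : 0 < e / (C + 1) by rewrite divr_gt0// ltr_wpDl.
have [w [m mw] zw] := Wz j _ e1; exists m => i mi.
have Ww : basic_span w.
  by move=> j' e' e'0; exists w; [exists m|rewrite subrr (sn0 (sp j'))].
have Wwz : basic_span (-1 *: z + w) by exact: basic_spanP.
have wz : p j (-1 *: z + w) = p j (z - w).
  by rewrite scaleN1r addrC (sn_distC (sp j)).
have E : z - expansion i z = (z - w) + expansion i (-1 *: z + w).
  by rewrite expansion_linear mw// scaleN1r [- _ + w]addrC addrA subrK.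
rewrite E; apply: le_lt_trans (snD (sp j) _ _) _.
have := CW i _ Wwz; rewrite wz => H.
apply: (@le_lt_trans _ _ ((C + 1) * p j (z - w))); first by lra.
by rewrite mulrC -ltr_pdivlMr// ltr_wpDl.
Qed.

End PerturbedBasis.

(** * Spaceability in terms of seminorms *)

(** s = 2^k 3^l 5^r encodes the pair (k, l), and r makes it as large as
desired. *)
Lemma pair_infinitely_often (k l r : nat) : exists s,
  [/\ (r <= s)%N, (k <= s)%N, logn 2 s = k & logn 3 s = l].
Proof.
have p5 i n : prime i -> i != 5 -> logn i (5 ^ n) = 0%N.
  by move=> pi i5; rewrite lognX logn_prime// (negbTE i5) muln0.
exists (2 ^ k * 3 ^ l * 5 ^ r)%N.
have g0 : (0 < 2 ^ k * 3 ^ l)%N by rewrite muln_gt0 !expn_gt0.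
have g5 : (0 < 5 ^ r)%N by rewrite expn_gt0.
split.
- by rewrite (leq_trans (ltnW (ltn_expl r (isT : (1 < 5)%N))))// leq_pmull.
- apply: leq_trans (ltnW (ltn_expl k (isT : (1 < 2)%N))) _.
  by rewrite -mulnA leq_pmulr// muln_gt0 !expn_gt0.
- rewrite !lognM ?expn_gt0// p5// addn0 !lognX (logn_prime 2 (isT : prime 3)).
  by rewrite (logn_prime 2 (isT : prime 2)) muln0 muln1 addn0.
- rewrite !lognM ?expn_gt0// p5// addn0 !lognX (logn_prime 3 (isT : prime 3)).
  by rewrite (logn_prime 3 (isT : prime 2)) muln0 muln1.
Qed.

Section SeminormSpaceability.
Variables (R : realType) (K : numFieldType) (F : real_scalars R K).
Variables (V : lmodType K) (p : nat -> V -> R).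
Hypothesis sp : forall j, real_seminorm F (p j).
Hypothesis p_incr : forall j x, p j x <= p j.+1 x.
Variable coord : nat -> {scalar V}.
Hypothesis coord_dominated : forall i, dominated p (fun x => absR F (coord i x)).
Hypothesis coord_inj : forall a, (forall i, coord i a = 0) -> a = 0.
Hypothesis complete : forall u : nat -> V,
  (forall j (e : R), 0 < e -> exists n, forall i k, (n <= i)%N -> (n <= k)%N ->
      p j (u i - u k) < e) ->
  exists l, forall j (e : R), 0 < e -> exists n, forall i, (n <= i)%N ->
      p j (u i - l) < e.
Hypothesis poly_dense : forall x j (eps : R), 0 < eps ->
  exists M d, supported coord 0 M d /\ p j (x - d) < eps.
Hypothesis ker_infcodim : ~ finite_codimensional [set x | p 0%N x = 0].

Variables (X : lmodType K) (q : nat -> X -> R).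
Hypothesis sq : forall j, real_seminorm F (q j).
Hypothesis q_incr : forall j y, q j y <= q j.+1 y.
Variable x : nat -> X.
Variable yd : nat -> X.
Hypothesis yd_dense : forall y j (e : R), 0 < e -> exists l, q j (y - yd l) < e.
Hypothesis universal_block : forall N j (e : R) y, 0 < e -> exists M b,
  [/\ supported coord N M b, p j b < e & q j (initial_sum coord x M b - y) < e].

(** The truncation of z at M is described by its coordinates, as the vector t. *)
Definition seminorm_universal (z : V) : Prop :=
  forall y j (e : R) n0, 0 < e -> exists M t,
    [/\ (n0 < M)%N, q j (initial_sum coord x M z - y) < e,
        supported coord 0 M t, forall i, (i < M)%N -> coord i t = coord i z &
        p j (z - t) < e].

(** The subspace W is the closed span of the vectors of block_family. Its
infinite dimension is certified by a biorthogonal system, and its closedness by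
seminorms alone. *)
Lemma seminorm_spaceable : exists (W : set V) (u : nat -> V) (coef : nat -> V -> K),
  [/\ forall a y z, W y -> W z -> W (a *: y + z),
      forall z, (forall j (e : R), 0 < e -> exists2 w, W w & p j (z - w) < e) -> W z,
      forall k, W (u k),
      forall k, scalar (coef k) /\ forall l, coef k (u l) = (l == k)%:R &
      forall z, W z -> z <> 0 -> seminorm_universal z].
Proof.
have [h [Mh [E [L [hM h1 ELP EL0 [EL_h EL_basic]]]]]] :=
  basic_block_sequence sp p_incr coord_dominated poly_dense ker_infcodim.
(* Stage s selects the vector u_k and the target yd l for k = logn 2 s and
   l = logn 3 s. *)
pose target s k := if k == logn 2 s then yd (logn 3 s) else 0 : X.
have h_supp n : supported coord (Mh n) (Mh n.+1) (h n) by have [] := hM n.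
have Mh_lt n : (Mh n < Mh n.+1)%N by have [] := hM n.
have [N [v [u [d [Nlt [ug uv] [ucoord vP] vq du]]]]] :=
  block_family sp p_incr coord_dominated coord_inj complete universal_block
    h_supp Mh_lt h1 target.
have Nmono := strict_incr_mono Nlt.
pose g k := h (N k).
have g_basic j i m (c : nat -> K) : (j <= i)%N -> (i <= m)%N ->
    p j (\sum_(k < i) c k *: g k) <= 2 * p j (\sum_(k < m) c k *: g k).
  move=> ji im.
  have Ei n : (n <= i)%N -> E (N i) (\sum_(k < n) c k *: g k).
    elim: n => [|n ih] ni; first by rewrite big_ord0; have [] := EL0 (N i).
    rewrite big_ord_recr /= addrC; have [+ _] := ELP (N i) (c n) (g n) (\sum_(k < n) c k *: g k).
    apply; last by apply: ih; exact: ltnW.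
    by apply: (proj1 (EL_h _ _)); rewrite (leqW_mono Nmono).
  have [n nP Ln] : exists2 l, L (N i) l &
      \sum_(k < m) c k *: g k = \sum_(k < i) c k *: g k + l.
    move: im => /subnK <-; elim: (m - i)%N => [|n [l Ll ih]].
      by exists 0; rewrite ?addr0//; have [] := EL0 (N i).
    exists (c (n + i)%N *: g (n + i)%N + l).
      have [_] := ELP (N i) (c (n + i)%N) (g (n + i)%N) l; apply => //.
      by apply: (proj2 (EL_h _ _)); rewrite Nmono leq_addl.
    by rewrite addSn big_ord_recr /= ih [_ *: _ + l]addrC addrA.
  rewrite Ln; apply: (EL_basic j (N i)) => //; last exact: Ei.
  by rewrite (leq_trans ji)// (leq_trans _ (strict_incr_ge Nlt i))// leq_addl.
have g1 k : p 0%N (g k) = 1 by exact: h1.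
pose coef k (z : V) : K := coord (d k) z / coord (d k) (u k).
have coef_scalar k : scalar (coef k).
  by move=> a y z; rewrite /coef linearP /= mulrDl mulrA.
have coef_dom k : dominated p (fun z => absR F (coef k z)).
  apply: dominated_le (dominatedZ (absR_ge0 F (coord (d k) (u k))^-1)
    (coord_dominated (d k))) => z.
  by rewrite /coef absRM mulrC.
have coef_u k l : coef k (u l) = (l == k)%:R.
  rewrite /coef; have [->|lk] := eqVneq l k.
    by rewrite divff// du negbK.
  by have := du k l; rewrite lk => /eqP ->; rewrite mul0r.
have sp_expansion := basic_span_expansion sp p_incr g_basic g1 ug coef_scalar coef_dom.
have coef_le := basic_span_coef_le sp p_incr g_basic g1 ug coef_scalar coef_dom.
exists (basic_span p u coef), u, coef; split.
- move=> a y z; exact: basic_spanP.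
- move=> z zW j e e0; have e2 : 0 < e / 2 by rewrite divr_gt0.
  have [w Ww zw] := zW j _ e2; have [w' Dw' ww'] := Ww j _ e2.
  exists w' => //; have := snD (sp j) (z - w) (w - w').
  by rewrite addrA subrK; lra.
- move=> k; exact: basic_span_basis.
- by [].
move=> z Wz z0 y j e n0 e0.
(* A vector of W without nonzero coefficient is the limit of its null
   partial expansions. *)
have [k0 /eqP ck0] : exists k, coef k z <> 0.
  apply/not_existsP => ck; apply: z0; apply: coord_inj => i.
  apply/eqP; rewrite -(absR_eq0 F) eq_le absR_ge0 andbT.
  have [C [J [C0 CJ]]] := coord_dominated i; apply: le_trans (CJ z) _.
  suff -> : p J z = 0 by rewrite mulr0.
  apply/eqP; rewrite eq_le (sn_ge0 (sp J)) andbT; apply/ler_addgt0Pr => r r0.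
  have [i0 /(_ i0 (leqnn _))] := sp_expansion z J r Wz r0.
  rewrite /expansion big1 => [|k _]; last by rewrite (contrapT (ck k)) scale0r.
  by rewrite subr0 add0r => /ltW.
set c0 := coef k0 z in ck0.
have ac0 : 0 < absR F c0 by rewrite lt_def absR_eq0 ck0 absR_ge0.
have e2 : 0 < e / 2 by rewrite divr_gt0.
have [l yl] := yd_dense (c0^-1 *: y) j (divr_gt0 e2 ac0).
have [i0 i0P] := sp_expansion z j _ Wz e2.
pose B := 8 * p 0%N z.
have B0 : 0 <= B by rewrite mulr_ge0// (sn_ge0 (sp 0)).
pose r := maxn (maxn i0 j) (maxn n0 (Num.truncn (4 * B / e))).
have [s [rs k0s s2 s3]] := pair_infinitely_often k0 l r.
have [i0s js n0s] : [/\ (i0 <= s)%N, (j <= s)%N & (n0 <= s)%N].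
  by move: rs; rewrite !geq_max => /andP[/andP[-> ->] /andP[-> _]].
have Bs : B * s.+1%:R^-1 < e / 4.
  have : 4 * B / e < s.+1%:R.
    rewrite (lt_le_trans (truncnS_gt _))// ler_nat ltnS.
    by move: rs; rewrite !geq_max => /andP[_ /andP[]].
  by rewrite !ltr_pdivrMr//; move: (s.+1%:R) => S; lra.
pose t := \sum_(k < s.+1) coef k z *: v s.+1 k.
(* Below N (s+1) only u_0, ..., u_s contribute, through the parts already
   built; this is checked on finite combinations and extended by continuity. *)
have tcoord i : (i < N s.+1)%N -> coord i t = coord i z.
  move=> iN.
  pose f (y : V) := y - \sum_(k < s.+1) coef k y *: v s.+1 k.
  have flin : scalar (coord i \o f).
    move=> a y1 y2 /=; rewrite -[RHS]linearP /=; congr (coord i _).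
    rewrite /f scalerBr addrACA scaler_sumr -opprD -big_split; congr (_ - _).
    by apply: eq_bigr => k _; rewrite /= coef_scalar scalerDl scalerA.
  suff : absR F (coord i (f z)) <= 0.
    rewrite le_eqVlt ltNge absR_ge0 orbF absR_eq0 linearB /= subr_eq0.
    by move=> /eqP ->.
  apply: (@sn_closure_le _ _ F _ p p_incr (finite_expansions u coef)
    (fun y => absR F (coord i (f y))) (fun=> 0)) Wz => //.
  - exact: real_seminorm_scalar flin.
  - exact: real_seminorm0.
  - apply: (dominated_comp (f := fun y => absR F (coord i y))) => // j'.
    apply: dominated_le (dominatedD p_incr (dominated_sn p j')
      (dominated_expansion sp p_incr coef_dom j' s.+1 (v s.+1))) => w.
    exact: (snB (sp j')).
  - by exists 0, 0%N; split => // w; rewrite mul0r.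
  move=> w [m mw]; suff -> : coord i (f w) = 0 by rewrite absR0.
  rewrite /f linearB /=; apply/eqP; rewrite subr_eq0; apply/eqP.
  have -> : coord i w = coord i (expansion u coef (maxn m s.+1) w).
    by rewrite mw// leq_maxl.
  rewrite /expansion !linear_sum /=.
  rewrite (big_ord_widen (n1 := s.+1) (maxn m s.+1) (fun k => coord i (coef k w *: v s.+1 k)));
    last exact: leq_maxr.
  rewrite [RHS]big_mkcond /=; apply: eq_bigr => k _.
  rewrite linearZ /= (ucoord s.+1)//; case: ltnP => ks; first by rewrite linearZ.
  by have [_ ->//] := vP s.+1 k; rewrite linear0 mulr0.
exists (N s.+1), t; split => //.
- have := strict_incr_ge Nlt s.+1; apply: leq_trans.
  by rewrite ltn_addl.
- have -> : initial_sum coord x (N s.+1) z = initial_sum coord x (N s.+1) t.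
    by apply: eq_bigr => i _; rewrite tcoord.
  have tE : initial_sum coord x (N s.+1) t - c0 *: yd l =
      \sum_(k < s.+1) coef k z *: (initial_sum coord x (N s.+1) (v s.+1 k) - target s k).
    have k0s' : (k0 < s.+1)%N by [].
    under eq_bigr do rewrite scalerBr.
    rewrite sumrB; congr (_ - _).
      rewrite /initial_sum; under [RHS]eq_bigr do rewrite scaler_sumr.
      rewrite exchange_big /=; apply: eq_bigr => i _.
      rewrite linear_sum scaler_suml; apply: eq_bigr => k _.
      by rewrite linearZ /= scalerA.
    rewrite (bigD1 (Ordinal k0s'))//= /target s2 s3 eqxx big1 ?addr0// => k.
    by rewrite -val_eqE /= => /negbTE ->; rewrite scaler0.
  have H1 : q j (initial_sum coord x (N s.+1) t - c0 *: yd l) <= B * s.+1%:R^-1.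
    apply: le_trans (sn_mono q_incr _ js) _; rewrite tE.
    apply: le_trans (sn_sum (sq s) _ _ _) _.
    apply: (@le_trans _ _ (\sum_(k < s.+1) B * block_error R s)).
      apply: ler_sum => k _; rewrite (snZ (sq s)).
      apply: ler_pM (absR_ge0 _ _) (sn_ge0 (sq s) _) (coef_le _ _ Wz) _.
      by apply/ltW/vq; rewrite -ltnS.
    rewrite sumr_const card_ord -[leLHS]mulr_natl mulrCA ler_wpM2l//.
    exact: block_error_small.
  have H2 : q j (c0 *: yd l - y) < e / 2.
    rewrite (sn_distC (sq j)).
    have -> : y - c0 *: yd l = c0 *: (c0^-1 *: y - yd l).
      by rewrite scalerBr scalerA divff// scale1r.
    by rewrite (snZ (sq j)) mulrC -ltr_pdivlMr.
  have := snD (sq j) (initial_sum coord x (N s.+1) t - c0 *: yd l) (c0 *: yd l - y).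
  by rewrite addrA subrK; have := le_lt_trans H1 Bs; lra.
- rewrite /t; apply: (big_ind (supported coord 0 (N s.+1))).
  + exact: supported0.
  + by move=> *; exact: supportedD.
  + move=> k _; rewrite -[_ *: _]addr0; apply: supportedP; last exact: supported0.
    by have [] := vP s.+1 k.
have -> : z - t = (z - expansion u coef s.+1 z) + (expansion u coef s.+1 z - t).
  by rewrite addrA subrK.
apply: le_lt_trans (snD (sp j) _ _) _.
have H1 := i0P s.+1 (leqW i0s).
have H2 : p j (expansion u coef s.+1 z - t) <= 2 * (B * s.+1%:R^-1).
  rewrite /expansion /t -sumrB; apply: le_trans (sn_sum (sp j) _ _ _) _.
  apply: (@le_trans _ _ (\sum_(k < s.+1) B * (2 * block_error R s))).
    apply: ler_sum => k _; rewrite -scalerBr (snZ (sp j)).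
    apply: ler_pM (absR_ge0 _ _) (sn_ge0 (sp j) _) (coef_le _ _ Wz) _.
    apply: le_trans (uv s.+1 k j (leqW js) (ltn_ord k)) _.
    by rewrite ler_wpM2l// block_error_le.
  rewrite sumr_const card_ord -[leLHS]mulr_natl (mulrCA B) (mulrCA _ 2) ler_wpM2l// mulrCA ler_wpM2l//.
  exact: block_error_small.
move: (B * _) Bs H2 => b Bs H2; lra.
Qed.

End SeminormSpaceability.

(** * Translation from topology to seminorms *)

Section RealValuedTopology.
Variables (R : realType) (K : numFieldType) (F : real_scalars R K).

Lemma re_le a b : 0 <= a -> 0 <= b -> (re F a <= re F b) = (a <= b).
Proof. by move=> a0 b0; rewrite -(emb_le F) !emb_re. Qed.

Lemma re_ge0 a : 0 <= a -> 0 <= re F a.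
Proof. by move=> a0; rewrite -(emb_ge0 F) emb_re. Qed.

Lemma re_lt a b : 0 <= a -> 0 <= b -> (re F a < re F b) = (a < b).
Proof.
move=> a0 b0; rewrite !lt_def re_le//; congr (~~ _ && _).
by apply/eqP/eqP => [/(congr1 (emb F))|->//]; rewrite !emb_re.
Qed.

Lemma re_seminorm (V : lmodType K) (p : V -> K) :
  seminorm p -> real_seminorm F (fun x => re F (p x)).
Proof.
move=> [p0 pZ pD]; split=> [x|a x|x y].
- exact: re_ge0.
- by rewrite pZ -{1}(emb_absR F) -{1}(emb_re F (p0 x)) -rmorphM re_emb.
- by rewrite -(emb_le F) rmorphD !emb_re.
Qed.

Definition real_topology (V : topologicalLmodType K) (p : nat -> V -> R) : Prop :=
  forall (x : V) (U : set V), nbhs x U <->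
    exists j (e : R), 0 < e /\ forall y, p j (x - y) < e -> U y.

Lemma countably_seminormed_real (V : topologicalLmodType K) :
  countably_seminormed V -> exists p : nat -> V -> R,
  [/\ forall j, real_seminorm F (p j), forall j x, p j x <= p j.+1 x &
      real_topology p].
Proof.
move=> [q [sq q_incr] qtop]; exists (fun j x => re F (q j x)).
have q0 j x : 0 <= q j x by have [] := sq j.
split=> [j|j x|x U]; first exact: re_seminorm.
  by rewrite re_le.
rewrite qtop; split.
  move=> [[j e] [_ /= e0] qU]; exists j, (re F e); split.
    by rewrite -(re_emb F 0) rmorph0 re_lt// ltW.
  by move=> y; rewrite re_lt ?(ltW e0)//; exact: qU.
move=> [j [e [e0 qU]]]; exists (j, emb F e) => [|y /= qy].
  by split => //=; rewrite lt_def emb_ge0 (ltW e0) andbT -(rmorph0 (emb F))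
    (inj_eq (can_inj (re_emb F))) gt_eqF.
apply: qU; rewrite -(re_emb F e) re_lt// emb_ge0; exact: ltW.
Qed.

Lemma real_topology_shift (V : topologicalLmodType K) (p : nat -> V -> R) m :
  (forall j x, p j x <= p j.+1 x) -> real_topology p ->
  real_topology (fun j => p (m + j)%N).
Proof.
move=> p_incr ptop x U; rewrite ptop; split=> [[j [e [e0 pU]]]|[j [e [e0 pU]]]].
  exists j, e; split => // y py; apply: pU; apply: le_lt_trans py.
  by apply: (sn_mono p_incr); exact: leq_addl.
by exists (m + j)%N, e.
Qed.

Section OneSpace.
Variables (V : topologicalLmodType K) (p : nat -> V -> R).
Hypothesis sp : forall j, real_seminorm F (p j).
Hypothesis ptop : real_topology p.

(** By homogeneity; if p j vanishes at x, then f is bounded on the line of x and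
must vanish there as well. *)
Lemma seminorm_dominated (f : V -> R) j (e : R) : real_seminorm F f -> 0 < e ->
  (forall x, p j x < e -> f x < 1) -> dominated p f.
Proof.
move=> sf e0 fe; exists (2 / e), j; split=> [|x]; first by rewrite divr_ge0// ltW.
have scale t : 0 < t -> t * p j x < e -> t * f x < 1.
  move=> t0 tp; have := fe (emb F t *: x).
  by rewrite (snZ (sp j)) (snZ sf) absR_emb ?(ltW t0)//; exact.
have [px0|px0] := eqVneq (p j x) 0.
  rewrite px0 mulr0 leNgt; apply/negP => fx0.
  have := scale (f x)^-1; rewrite invr_gt0 px0 mulr0 mulVf ?gt_eqF// ltxx.
  by move=> /(_ fx0 e0).
have {}px0 : 0 < p j x by rewrite lt_def px0 (sn_ge0 (sp j)).
have t0 : 0 < e / (2 * p j x) by rewrite divr_gt0// mulr_gt0.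
have := scale _ t0; rewrite invfM !mulrA mulfVK ?gt_eqF// ltr_pdivrMr// ltr_pMr//.
rewrite ltr1n => /(_ isT) fx; rewrite -ler_pdivrMl ?divr_gt0// invf_div.
apply: ltW; move: fx; rewrite mulrAC ltr_pdivrMr// mul1r.
by [].
Qed.

Lemma continuous_dominated (f : V -> K^o) : continuous f ->
  real_seminorm F (fun x => absR F (f x)) -> dominated p (fun x => absR F (f x)).
Proof.
move=> fc sf.
have f0 : f 0 = 0 by apply/eqP; rewrite -(absR_eq0 F) (sn0 sf).
have := fc 0 _ (nbhsx_ballx (f 0) 1 ltr01) => /ptop[j [e [e0 pf]]].
apply: (seminorm_dominated (j := j) sf e0) => x px.
have := pf x; rewrite sub0r (snN (sp j)) => /(_ px).
rewrite -ball_normE /ball_ /= f0 sub0r normrN => fx1.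
by rewrite -(re_emb F 1) rmorph1 re_lt.
Qed.

Lemma real_topology_cvg (u : nat -> V) (l : V) :
  u @ \oo --> l <-> forall j (e : R), 0 < e -> exists n, forall i, (n <= i)%N ->
    p j (u i - l) < e.
Proof.
split=> [ul j e e0|ul U /ptop[j [e [e0 pU]]]].
  have [|n _ nP] := ul [set y | p j (l - y) < e].
    by apply/ptop; exists j, e.
  by exists n => i ni; rewrite (sn_distC (sp j)); exact: nP.
have [n nP] := ul j e e0; exists n => // i /= ni.
by apply: pU; rewrite (sn_distC (sp j)); exact: nP.
Qed.

Lemma real_topology_dense (D : set V) (x : V) j (e : R) : dense D -> 0 < e ->
  exists2 d, D d & p j (x - d) < e.
Proof.
move=> dD e0.
have xU : nbhs x [set y | p j (x - y) < e] by apply/ptop; exists j, e.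
have [|d [/interior_subset xd Dd]] := dD (interior [set y | p j (x - y) < e]) _ (open_interior _).
  by exists x.
by exists d.
Qed.

Lemma real_topology_cauchy (u : nat -> V) :
  (forall j (e : R), 0 < e -> exists n, forall i k, (n <= i)%N -> (n <= k)%N ->
      p j (u i - u k) < e) -> tvs_cauchy u.
Proof.
move=> uc U /ptop[j [e [e0 pU]]]; have [n nP] := uc j e e0.
exists ([set i | (n <= i)%N], [set i | (n <= i)%N]); first by split; exists n.
move=> [i k] /= [ni nk]; apply: pU; rewrite sub0r (snN (sp j)); exact: nP.
Qed.

Lemma real_topology_closed (W : set V) :
  (forall z, (forall j (e : R), 0 < e -> exists2 w, W w & p j (z - w) < e) -> W z) ->
  closed W.
Proof.
move=> WP z clz; apply: WP => j e e0.
have [|w [Ww zw]] := clz [set y | p j (z - y) < e]; first by apply/ptop; exists j, e.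
by exists w.
Qed.

End OneSpace.
End RealValuedTopology.

(** n+1 of the vectors u_k in the span of n vectors would satisfy a nontrivial
linear relation, which the biorthogonal functionals exclude. *)
Lemma biorthogonal_infinite_dimensional (K : numFieldType) (V : lmodType K)
    (W : set V) (u : nat -> V) (coef : nat -> V -> K) :
  (forall k, W (u k)) ->
  (forall k, scalar (coef k) /\ forall l, coef k (u l) = (l == k)%:R) ->
  ~ finite_dimensional W.
Proof.
move=> Wu coefP [n [b WE]].
have /choice[c cP] : forall k, exists c : 'I_n -> K, u k = \sum_i c i *: b i.
  by move=> k; have := Wu k; rewrite WE.
pose M : 'M[K]_(n.+1, n) := \matrix_(k, i) c k i.
have /rowV0Pn[v /sub_kermxP vM v0] : kermx M != 0.
  rewrite kermx_eq0 /row_free; apply: contraTneq (rank_leq_col M) => ->.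
  by rewrite ltnn.
have vu : \sum_(k < n.+1) v 0 k *: u k = 0.
  under eq_bigr do rewrite cP scaler_sumr.
  rewrite exchange_big big1// => i _ /=.
  under eq_bigr do rewrite scalerA.
  rewrite -scaler_suml; have := congr1 (fun m : 'rV_n => m 0 i) vM.
  rewrite !mxE => vMi; rewrite -[X in X *: _](_ : \sum_k v 0 k * M k i = _).
    by rewrite vMi scale0r.
  by apply: eq_bigr => k _; rewrite mxE.
have coef_sum k m (a : nat -> K) (w : nat -> V) :
    coef k (\sum_(l < m) a l *: w l) = \sum_(l < m) a l * coef k (w l).
  have [cl _] := coefP k; elim: m => [|m ih].
    by rewrite !big_ord0; have := cl (-1) 0 0; rewrite scaler0 addr0 mulN1r addNr.
  by rewrite !big_ord_recr /= addrC cl ih addrC.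
apply/negP: v0; rewrite negbK; apply/eqP/rowP => k; rewrite mxE.
have [_ cu] := coefP k; have := coef_sum k n.+1 (fun l => v 0 (inord l)) u.
under eq_bigr do rewrite inord_val; rewrite vu.
have -> : coef k 0 = 0.
  by have := coef_sum k 0%N (fun=> 0) u; rewrite !big_ord0.
under eq_bigr do rewrite inord_val cu.
rewrite (bigD1 k)//= eqxx mulr1 big1 ?addr0// => l.
by rewrite -val_eqE /= => /negbTE ->; rewrite mulr0.
Qed.

(** * Sequence spaces *)

Section SequenceSpace.
Variables (R : realType) (K : numFieldType) (F : real_scalars R K).
Variables (P : pred (nat -> K^o)) (A : topSubLmodType P).

Let coordinate_scalar m : scalar (fun a : A => coordinate m a : K).
Proof. by move=> a y z; rewrite /coordinate linearP. Qed.

Definition coord m : {scalar A} :=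
  HB.pack (fun a : A => coordinate m a : K)
    (GRing.isLinear.Build K A K *%R _ (coordinate_scalar m)).

Lemma coord_inj (a : A) : (forall m, coord m a = 0) -> a = 0.
Proof.
move=> a0; apply: val_inj; rewrite linear0; apply/funext => m; exact: a0.
Qed.

Hypothesis polyA : forall a : nat -> K^o, polynomial_seq a -> P a.

Lemma coord_basisA m n : coord m (basisA A n) = (m == n)%:R.
Proof.
rewrite -[LHS]/((\val (basisA A n) : nat -> K^o) m) insubdK//.
apply: polyA; apply: (@sub_finite_set _ _ [set n]); last exact: finite_set1.
by move=> i /=; rewrite /canonical_basis; have [->//|_] := eqVneq i n; rewrite eqxx.
Qed.

Lemma coord_partial_sumA k (a : A) m :
  coord m (partial_sumA k a) = if (m <= k)%N then coord m a else 0.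
Proof.
rewrite /partial_sumA linear_sum.
under eq_bigr => n _ do rewrite linearZ coord_basisA /=.
case: leqP => mk; last first.
  rewrite big1// => n _; case: eqP => [mn|_]; last by rewrite mulr0.
  by move: mk; rewrite mn ltnNge -ltnS ltn_ord.
rewrite (bigD1 (Ordinal (mk : (m < k.+1)%N)))//= eqxx mulr1 big1 ?addr0// => n.
by rewrite -val_eqE eq_sym /= => /negbTE ->; rewrite mulr0.
Qed.

Lemma partial_sumA_unique k (a t : A) : supported coord 0 k.+1 t ->
  (forall i, (i < k.+1)%N -> coord i t = coord i a) -> partial_sumA k a = t.
Proof.
move=> st ta; apply/eqP; rewrite -subr_eq0; apply/eqP/coord_inj => m.
rewrite linearB coord_partial_sumA; case: leqP => mk.
  by rewrite ta// subrr.
by rewrite st ?subrr// -ltnNge.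
Qed.

Lemma polynomial_supported (a : A) : polynomial_seq (\val a : nat -> K) ->
  exists M, supported coord 0 M a.
Proof.
move=> /finite_seqP[s sE]; exists (\max_(i <- s) i.+1) => i iM.
apply: contraNeq iM => ai; have : i \in s.
  by have : [set n | (\val a : nat -> K) n != 0] i by []; rewrite sE.
by move=> si; exact: (@leq_bigmax_seq _ s xpredT (fun i => i.+1) i si isT).
Qed.

Variables (p : nat -> A -> R).
Hypothesis sp : forall j, real_seminorm F (p j).
Hypothesis p_incr : forall j x, p j x <= p j.+1 x.
Hypothesis ptop : real_topology p.
Variables (X : topologicalLmodType K) (q : nat -> X -> R).
Hypothesis sq : forall j, real_seminorm F (q j).
Hypothesis q_incr : forall j y, q j y <= q j.+1 y.
Hypothesis qtop : real_topology q.
Variable x : nat -> X.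

Lemma strict_incr_cofinal (n : nat -> nat) k : {homo n : i j / (i < j)%N} ->
  forall i, (k <= i)%N -> (k <= n i)%N.
Proof.
move=> nh i ki; apply: leq_trans ki _; elim: i => // i ih.
by apply: leq_ltn_trans ih _; exact: nh.
Qed.

(** The block is the difference of two truncations of one universal series a,
the first one near a, the second one near a with its partial sum near the first
partial sum plus y. *)
Lemma restricted_universal_block : restricted_universal_series A x !=set0 ->
  forall N j (e : R) y, 0 < e -> exists M b,
  [/\ supported coord N M b, p j b < e & q j (initial_sum coord x M b - y) < e].
Proof.
move=> [a aU] N j e y e0; have e2 : 0 < e / 2 by rewrite divr_gt0.
have approx y' N' : exists n, [/\ (N' <= n)%N, p j (partial_sumA n a - a) < e / 2 &
    q j (partial_sum x n a - y') < e].
  have [n [n0 nh ny na]] := aU y'.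
  have [i1 i1P] := (real_topology_cvg sq qtop _ _).1 ny j e e0.
  have [i2 i2P] := (real_topology_cvg sp ptop _ _).1 na j _ e2.
  pose i := maxn N' (maxn i1 i2); exists (n i); split.
  - by apply: strict_incr_cofinal => //; exact: leq_maxl.
  - by apply: i2P; rewrite !leq_max leqnn !orbT.
  - by apply: i1P; rewrite !leq_max leqnn !orbT.
have [m [Nm pm _]] := approx y N.
have [n [mn pn qn]] := approx (y + partial_sum x m a) m.
exists n.+1, (partial_sumA n a - partial_sumA m a); split.
- move=> i iN; rewrite linearB !coord_partial_sumA.
  case: (leqP i n) => in_; last by rewrite ifN ?subrr// -ltnNge (leq_ltn_trans mn).
  case: (leqP i m) => im; first by rewrite subrr.
  by move: iN; rewrite (leq_trans Nm (ltnW im)) ltnS in_.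
- have := snB (sp j) (partial_sumA n a - a) (partial_sumA m a - a).
  by rewrite opprB addrA subrK; lra.
rewrite -[initial_sum _ _ _ _](_ : partial_sum x n a - partial_sum x m a = _).
  by rewrite -addrA -opprD (addrC _ y).
have linS := @initial_sumP K A coord X x n.+1.
have := linS (-1) (partial_sumA m a) (partial_sumA n a); rewrite !scaleN1r.
rewrite [X in initial_sum _ _ _ X]addrC => ->; rewrite [RHS]addrC; congr (_ - _).
  by apply: eq_bigr => i _; rewrite coord_partial_sumA -ltnS ltn_ord.
rewrite (@initial_sum_stable _ _ _ _ _ m.+1) //.
  by apply: eq_bigr => i _; rewrite coord_partial_sumA -ltnS ltn_ord.
by move=> i; rewrite coord_partial_sumA /= ltnS => /negbTE ->.
Qed.

Lemma seminorm_universal_restricted (z : A) :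
  seminorm_universal p coord q x z -> restricted_universal_series A x z.
Proof.
move=> zU y; pose I (_ M : nat) := (0 < M)%N.
pose Q s (M M' : nat) := [/\ (M < M')%N,
  q s (initial_sum coord x M' z - y) < s.+1%:R^-1 &
  p s (partial_sumA M'.-1 z - z) < s.+1%:R^-1].
have [|s M M0|M [M0 MP]] := @invariant_dependent_choice nat I Q 1%N.
- by [].
- have e0 : 0 < s.+1%:R^-1 :> R by rewrite invr_gt0.
  have [M' [t [MM' qM st tz pt]]] := zU y s _ M e0.
  have M'0 : (0 < M')%N by exact: leq_ltn_trans MM'.
  exists M'; split => //; split => //.
  rewrite (@partial_sumA_unique M'.-1 z t) ?prednK//.
  by rewrite (sn_distC (sp s)).
have Mlt s : (M s < M s.+1)%N by have [_ []] := MP s.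
have M1 s : (1 < M s.+1)%N.
  by have := strict_incr_ge Mlt s.+1; rewrite M0; apply: leq_trans.
exists (fun k => (M k.+1).-1); split.
- by move=> k; rewrite -ltnS prednK ?M1// ltnW// M1.
- move=> i j ij; rewrite -ltnS !prednK ?(ltnW (M1 _))//.
  by rewrite (leqW_mono (strict_incr_mono Mlt)).
- apply/(real_topology_cvg sq qtop) => j e e0.
  exists (maxn j (Num.truncn e^-1)) => i; rewrite geq_max => /andP[ji ie].
  apply: le_lt_trans (invS_lt e0 ie).
  apply: le_trans (sn_mono q_incr _ ji) _; have [_ [_ + _]] := MP i.
  by rewrite /partial_sum prednK ?(ltnW (M1 i))// => /ltW.
- apply/(real_topology_cvg sp ptop) => j e e0.
  exists (maxn j (Num.truncn e^-1)) => i; rewrite geq_max => /andP[ji ie].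
  apply: le_lt_trans (invS_lt e0 ie).
  by apply: le_trans (sn_mono p_incr _ ji) _; have [_ [_ _ /ltW]] := MP i.
Qed.

(** yd inverts an injection of a countable dense set into nat, with value 0 at
the numbers that are not codes. *)
Lemma separable_dense_sequence : separable_space X ->
  exists yd : nat -> X, forall y j (e : R), 0 < e -> exists l, q j (y - yd l) < e.
Proof.
move=> [D /countable_injP[f finj] dD].
have /choice[yd ydP] : forall l, exists y, forall y', D y' -> f y' = l -> y = y'.
  move=> l; have [[y [Dy fy]]|no] := pselect (exists y, D y /\ f y = l).
    by exists y => y' Dy' fy'; apply: finj; rewrite ?inE// fy.
  by exists 0 => y' Dy' fy'; exfalso; apply: no; exists y'.
exists yd => y j e e0.
have [d Dd yd_] := real_topology_dense qtop y j dD e0.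
by exists (f d); rewrite (ydP _ d).
Qed.

End SequenceSpace.

Lemma spaceable_over_real_scalars (R : realType) (K : numFieldType)
    (F : real_scalars R K)
    (P : pred (nat -> K^o)) (A : topSubLmodType P) (frechetA : frechet A)
    (coord_cont : forall m : nat, continuous (fun a : A => coordinate m a))
    (polyA : forall a : nat -> K^o, polynomial_seq a -> P a)
    (poly_dense : dense [set a : A | polynomial_seq (\val a : nat -> K)])
    (X : topologicalLmodType K)
    (seminormedX : countably_seminormed X) (separableX : separable_space X)
    (x : nat -> X) :
  restricted_universal_series A x !=set0 ->
  (exists p : A -> K^o,
     [/\ seminorm p, continuous p & ~ finite_codimensional [set a | p a = 0]]) ->
  spaceable (restricted_universal_series A x).
Proof.
move=> nonempty [p0 [sp0 p0c infcodim]].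
have [_ seminormedA completeA] := frechetA.
have [p' [sp' p'_incr p'top]] := countably_seminormed_real F seminormedA.
have [q [sq q_incr qtop]] := countably_seminormed_real F seminormedX.
have abs_p0 a : absR F (p0 a) = re F (p0 a).
  by have [p0ge _ _] := sp0; rewrite /absR ger0_norm.
have [C [J [C0 p0C]]] : dominated p' (fun a => absR F (p0 a)).
  apply: (continuous_dominated sp' p'top p0c).
  by rewrite (funext abs_p0); exact: re_seminorm.
(* Dropping the first J seminorms makes ker p_0 of infinite codimension. *)
pose p j := p' (J + j)%N.
have sp j : real_seminorm F (p j) by exact: sp'.
have p_incr j a : p j a <= p j.+1 a by rewrite /p addnS.
have ptop : real_topology p by exact: real_topology_shift.
have ker_infcodim : ~ finite_codimensional [set a | p 0%N a = 0].
  move=> [n [b bP]]; apply: infcodim; exists n, b => v.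
  have [w [z [w0 bz vE]]] := bP v; exists w, z; split => //.
  apply/eqP; rewrite /= -(absR_eq0 F) eq_le absR_ge0 andbT.
  by apply: le_trans (p0C w) _; move: w0; rewrite /= /p addn0 => ->; rewrite mulr0.
have coord_dom i : dominated p (fun a => absR F (coord A i a)).
  apply: (continuous_dominated sp ptop (coord_cont i)).
  exact: real_seminorm_scalar (linearP (coord A i)).
have complete (u : nat -> A) :
    (forall j (e : R), 0 < e -> exists n, forall i k, (n <= i)%N -> (n <= k)%N ->
      p j (u i - u k) < e) ->
    exists l, forall j (e : R), 0 < e -> exists n, forall i, (n <= i)%N ->
      p j (u i - l) < e.
  move=> uc; have [l ul] := completeA u (real_topology_cauchy sp ptop uc).
  by exists l; exact/(real_topology_cvg sp ptop).
have approx a j (e : R) : 0 < e ->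
    exists M d, supported (coord A) 0 M d /\ p j (a - d) < e.
  move=> e0; have [d /polynomial_supported[M Md] ad] :=
    real_topology_dense ptop a j poly_dense e0.
  by exists M, d.
have [yd yd_dense] := separable_dense_sequence qtop separableX.
have [W [u [coef [WP Wclosed Wu coefP Wuniv]]]] :=
  seminorm_spaceable sp p_incr coord_dom (@coord_inj K P A) complete approx
    ker_infcodim sq q_incr yd_dense
    (restricted_universal_block polyA sp ptop sq qtop nonempty).
exists W; split.
- split=> [|a y z].
    have := WP (-1) (u 0%N) (u 0%N) (Wu _) (Wu _).
    by rewrite scaleN1r addNr => W0; exact/mem_set.
  by rewrite !inE; exact: WP.
- by apply: (real_topology_closed ptop).
- exact: biorthogonal_infinite_dimensional Wu coefP.
move=> z Wz; have [->|z0] := pselect (z = 0); [by right|left].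
exact: (seminorm_universal_restricted polyA sp p_incr ptop sq q_incr qtop) (Wuniv z Wz z0).
Qed.

Theorem theorem2p6 (R : realType) (K : numFieldType) (hK : real_or_complex R K)
    (P : pred (nat -> K^o)) (A : topSubLmodType P) (frechetA : frechet A)
    (coord_cont : forall m : nat, continuous (fun a : A => coordinate m a))
    (polyA : forall a : nat -> K^o, polynomial_seq a -> P a)
    (poly_dense : dense [set a : A | polynomial_seq (\val a : nat -> K)])
    (X : topologicalLmodType K)
    (seminormedX : countably_seminormed X) (separableX : separable_space X)
    (x : nat -> X) :
  restricted_universal_series A x !=set0 ->
  (exists p : A -> K^o,
     [/\ seminorm p, continuous p & ~ finite_codimensional [set a | p a = 0]]) ->
  spaceable (restricted_universal_series A x).
Proof.
have [F] : inhabited (real_scalars R K).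
  by case: hK => ->; constructor; [exact: real_scalars_R|exact: real_scalars_C].
exact: (spaceable_over_real_scalars F).
Qed.
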